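(* Let $(Y_i)_{i\in\mathbb{N}}$ be operator spaces all of which are completely isomorphic to $\mathrm{MIN}(\ell_2)$. If $X\in\{R,\,C,\,R\cap C,\,\mathrm{MAX}(\ell_2)\}$, then $X$ does not completely isomorphically embed into $(\bigoplus_i Y_i)_{c_0}$.
   Context: Let $(e_{ij})_{i,j\in\mathbb{N}}$ be the matrix units of $B(\ell_2)$. $R=\overline{\mathrm{span}}\{e_{1i}: i\in\mathbb{N}\}$ and $C=\overline{\mathrm{span}}\{e_{i1}: i\in\mathbb{N}\}$ are the row and column operator spaces in $B(\ell_2)$; $r\colon\ell_2\to R$ and $c\colon \ell_2\to C$ are the isometries with $r(e_i)=e_{1i}$, $c(e_i)=e_{i1}$. $R\cap C$ is $\ell_2$ with the operator space structure given by the embedding $x\mapsto (r(x),c(x))\in R\oplus_\infty C$. For a Banach space $E$: $\mathrm{MIN}(E)$ is $E$ with the operator space structure coming from the canonical embedding $E\subset C(B_{E^*})$; $\mathrm{MAX}(E)$ is $E$ with $\|[x_{ij}]\|_{\mathrm{M}_k}=\sup_u\|[u(x_{ij})]\|$, the supremum over all linear contractions $u\colon E\to B(H_u)$, $H_u$ Hilbert spaces. $(\bigoplus_i Y_i)_{c_0}$ is the space of sequences $(y_i)_i$, $y_i\in Y_i$, $\|y_i\|\to0$, with $\|[x_{ij}]\|_{\mathrm{M}_k}=\sup_n\|[x_{ij}(n)]\|_{\mathrm{M}_k(Y_n)}$. A complete isomorphic embedding is a completely bounded injective linear map whose inverse, defined on its image, is completely bounded. The isomorphism constants between $Y_i$ and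 $\mathrm{MIN}(\ell_2)$ need not be uniformly bounded in $i$. *)

(* Defs.v *)
From HB Require Import structures.
From mathcomp Require Import all_boot all_order all_algebra.
From mathcomp Require Import all_classical all_reals all_analysis.
From mathcomp Require Import complex ring lra.
Set Implicit Arguments.
Unset Strict Implicit.
Unset Printing Implicit Defensive.
Import Order.TTheory GRing.Theory Num.Theory.
Import numFieldNormedType.Exports.
Local Open Scope classical_set_scope.
Local Open Scope ring_scope.
Local Open Scope complex_scope.

(* The library norm on a module over [R[i]] takes its values in [R[i]]; [nrm]
   is the same norm with values in [R]. *)
Definition nrm (R : realType) (V : normedZmodType R[i]) (x : V) : R :=
  complex.Re `|x|.

Section nrm_theory.
Variables (R : realType).

Lemma nrmE (V : normedZmodType R[i]) (x : V) : `|x| = (nrm x)%:C.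
Proof.
have := normr_ge0 x; rewrite /nrm; case: `|x| => a b.
by rewrite lecE /= => /andP[/eqP -> _].
Qed.

Lemma nrm_ge0 (V : normedZmodType R[i]) (x : V) : 0 <= nrm x.
Proof. by have := normr_ge0 x; rewrite nrmE lecR. Qed.

Lemma nrmD (V : normedZmodType R[i]) (x y : V) : nrm (x + y) <= nrm x + nrm y.
Proof. by have := ler_normD x y; rewrite !nrmE -rmorphD /= lecR. Qed.

Lemma nrm0 (V : normedZmodType R[i]) : nrm (0 : V) = 0.
Proof. by rewrite /nrm normr0. Qed.

Lemma nrmN (V : normedZmodType R[i]) (x : V) : nrm (- x) = nrm x.
Proof. by rewrite /nrm normrN. Qed.

Lemma nrm0_eq0 (V : normedZmodType R[i]) (x : V) : nrm x = 0 -> x = 0.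
Proof. by move=> h; apply/eqP; rewrite -normr_eq0 nrmE h. Qed.

Lemma nrmM (a b : R[i]) : nrm (a * b) = nrm a * nrm b.
Proof. by apply: (@complexI R); rewrite rmorphM /= -!nrmE normrM. Qed.

Lemma nrmZ (V : normedModType R[i]) (a : R[i]) (x : V) :
  nrm (a *: x) = nrm a * nrm x.
Proof. by apply: (@complexI R); rewrite rmorphM /= -!nrmE normrZ. Qed.

Lemma nrm_real (a : R) : 0 <= a -> nrm (a%:C) = a.
Proof.
by move=> a0; apply: (@complexI R); rewrite -nrmE ger0_norm // lecR.
Qed.

Lemma nrm_sqr (a : R[i]) : nrm a ^+ 2 = complex.Re a ^+ 2 + complex.Im a ^+ 2.
Proof.
rewrite /nrm normc_def /= sqr_sqrtr //.
by rewrite addr_ge0 ?sqr_ge0.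
Qed.

Lemma nrm_conj (a : R[i]) : nrm (Num.conj a) = nrm a.
Proof. by rewrite /nrm norm_conjC. Qed.

Lemma Re_le_nrm (a : R[i]) : `|complex.Re a| <= nrm a.
Proof.
rewrite -[leRHS](ger0_norm (nrm_ge0 a)) -ler_sqr ?nnegrE ?normr_ge0 //.
rewrite !real_normK ?num_real // nrm_sqr lerDl sqr_ge0 //.
Qed.

Lemma Im_le_nrm (a : R[i]) : `|complex.Im a| <= nrm a.
Proof.
rewrite -[leRHS](ger0_norm (nrm_ge0 a)) -ler_sqr ?nnegrE ?normr_ge0 //.
rewrite !real_normK ?num_real // nrm_sqr lerDr sqr_ge0 //.
Qed.

End nrm_theory.

(* [inner] is linear in its first argument *)
Record hilbertSpace (R : realType) := HilbertSpace {
  hcarrier :> completeNormedModType R[i];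
  inner : {dot hcarrier for Num.conj};
  innerE : forall x, inner x x = `|x| ^+ 2 }.
Arguments inner {R h}.

Section bounded_operators.
Variables (R : realType) (H : hilbertSpace R).

Definition bounded_op : {pred H -> H} :=
  [pred a | `[< linear a /\ continuous a >]].

Record bop := Bop { bop_fun :> H -> H; _ : bop_fun \in bounded_op }.

HB.instance Definition _ := [isSub for bop_fun].
HB.instance Definition _ := [Choice of bop by <:].

Lemma bopP (a : bop) : linear a /\ continuous a.
Proof. by case: a => a /= /asboolP. Qed.

Lemma bounded_op_closed : submod_closed bounded_op.
Proof.
split; first by apply/asboolP; split=> [k x y|x]; [rewrite scaler0 addr0|exact: cvg_cst].
move=> k a b /asboolP[al ac] /asboolP[bl bc]; apply/asboolP; split.
  move=> l x y; rewrite !addrfctE !scalrfctE al bl.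
  by rewrite !scalerDr !scalerA (mulrC k) -!addrA; congr (_ + _); rewrite addrCA.
by move=> x; apply: cvgD; [apply: cvgZr; exact: ac|exact: bc].
Qed.

HB.instance Definition _ := GRing.isSubmodClosed.Build _ _ _ bounded_op_closed.
HB.instance Definition _ := [SubChoice_isSubLmodule of bop by <:].

Definition bop_linear (a : bop) : {linear H -> H} :=
  HB.pack (a : H -> H) (GRing.isLinear.Build _ _ _ _ _ (bopP a).1).

Definition opnorm (a : bop) : R := sup [set nrm (a x) | x in [set x | nrm x <= 1]].

Lemma bop_bound (a : bop) : exists2 M : R, 0 < M & forall x, nrm (a x) <= M * nrm x.
Proof.
have /linear_bounded_continuous/linear_boundedP/pinfty_ex_gt0[M M0 hM] :=
  (bopP a).2 : continuous (bop_linear a).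
have ME : M = (complex.Re M)%:C.
  by case: M M0 {hM} => u v; rewrite ltcE /= => /andP[/eqP -> _].
exists (complex.Re M); first by rewrite -ltcR -ME.
by move=> x; rewrite -lecR rmorphM /= -ME -!nrmE; exact: hM.
Qed.

Lemma opnorm_has_sup (a : bop) :
  has_sup [set nrm (a x) | x in [set x : H | nrm x <= 1]].
Proof.
split; first by exists (nrm (a 0)), 0 => //=; rewrite nrm0.
have [M M0 hM] := bop_bound a.
exists M => _ [x /= x1 <-].
by apply: le_trans (hM x) _; rewrite ler_piMr // ltW.
Qed.

Lemma opnorm_le (a : bop) (M : R) :
  (forall x, nrm x <= 1 -> nrm (a x) <= M) -> opnorm a <= M.
Proof.
move=> h; apply: ge_sup; first by case: (opnorm_has_sup a).
by move=> _ [x /= x1 <-]; exact: h.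
Qed.

Lemma opnorm_ge0 (a : bop) : 0 <= opnorm a.
Proof.
apply: (le_trans (nrm_ge0 (a 0))); apply: (sup_upper_bound (opnorm_has_sup a)).
by exists 0 => //=; rewrite nrm0.
Qed.

Lemma bop0 (a : bop) : a 0 = 0.
Proof. exact: (linear0 (bop_linear a)). Qed.

Lemma bopZ (a : bop) k x : a (k *: x) = k *: a x.
Proof. exact: (linearZ_LR (bop_linear a)). Qed.

Lemma opnormP (a : bop) x : nrm (a x) <= opnorm a * nrm x.
Proof.
have [->|x0] := eqVneq x 0; first by rewrite bop0 !nrm0 mulr0.
have nx0 : 0 < nrm x.
  by rewrite lt_neqAle nrm_ge0 eq_sym andbT; apply: contra x0 => /eqP/nrm0_eq0 ->.
have : nrm (a ((nrm x)^-1%:C *: x)) <= opnorm a.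
  apply: (sup_upper_bound (opnorm_has_sup a)); exists ((nrm x)^-1%:C *: x) => //=.
  by rewrite nrmZ nrm_real ?invr_ge0 ?nrm_ge0 // mulVf // gt_eqF.
rewrite bopZ nrmZ nrm_real ?invr_ge0 ?nrm_ge0 //.
by rewrite ler_pdivrMl // mulrC.
Qed.

Let norm (a : bop) : R[i] := (opnorm a)%:C.

Let normD a b : norm (a + b) <= norm a + norm b.
Proof.
rewrite /norm -rmorphD /= lecR; apply: opnorm_le => x x1.
rewrite [(a + b) x](_ : _ = a x + b x) //; apply: le_trans (nrmD _ _) _.
apply: lerD; (apply: le_trans (opnormP _ _) _); rewrite ler_piMr ?opnorm_ge0//.
Qed.

Let normZ k a : norm (k *: a) = `|k| * norm a.
Proof.
have le k' a' : opnorm (k' *: a') <= nrm k' * opnorm a'.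
  apply: opnorm_le => x x1; rewrite [(k' *: a') x](_ : _ = k' *: a' x) // nrmZ.
  apply: ler_wpM2l; first exact: nrm_ge0.
  by apply: le_trans (opnormP _ _) _; rewrite ler_piMr ?opnorm_ge0.
rewrite /norm nrmE -rmorphM /=; congr (_%:C); apply/eqP; rewrite eq_le le /=.
have [->|k0] := eqVneq k 0; first by rewrite nrm0 mul0r opnorm_ge0.
have nk0 : 0 < nrm k.
  by rewrite lt_neqAle nrm_ge0 eq_sym andbT; apply: contra k0 => /eqP/nrm0_eq0 ->.
have := le k^-1 (k *: a); rewrite scalerA mulVf // scale1r => h.
rewrite -ler_pdivlMl //; apply: le_trans h _.
rewrite [nrm k^-1](_ : _ = (nrm k)^-1) //.
apply: (mulfI (lt0r_neq0 nk0)); rewrite -nrmM (mulfV k0).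
rewrite (mulfV (lt0r_neq0 nk0)).
by rewrite (nrm_real ler01).
Qed.

Let norm0_eq0 a : norm a = 0 -> a = 0.
Proof.
move=> /complexI a0; apply/val_inj/funext => x /=; apply/nrm0_eq0/eqP.
by rewrite eq_le nrm_ge0 andbT; apply: le_trans (opnormP _ _) _; rewrite a0 mul0r.
Qed.

HB.instance Definition _ := Lmodule_isNormed.Build R[i] bop normD normZ norm0_eq0.

Lemma nrm_bop (a : bop) : nrm a = opnorm a.
Proof. by []. Qed.

End bounded_operators.

(* [sup] is 0 on a set of reals that is empty or unbounded; the [_has_sup]
   lemmas rule this out for every supremum used as a norm. *)

Section matrix_norms.
Variable R : realType.

(* the norm of the [k]-fold Hilbert sum *)
Definition l2norm (V : normedZmodType R[i]) k (h : 'cV[V]_k) : R :=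
  Num.sqrt (\sum_i nrm (h i 0) ^+ 2).

(* the norm of [M_k] as the algebra of operators on the Hilbert space [C^k] *)
Definition smxnorm k (A : 'M[R[i]]_k) : R :=
  sup [set l2norm (A *m v) | v in [set v : 'cV[R[i]]_k | l2norm v <= 1]].

(* the norm of [M_k(B(H))], identified with [B(H^k)] *)
Definition opmxnorm (H : hilbertSpace R) k (a : 'M[bop H]_k) : R :=
  sup [set l2norm (\col_i \sum_j a i j (h j 0)) |
       h in [set h : 'cV[H]_k | l2norm h <= 1]].

Lemma l2norm0 (V : normedZmodType R[i]) k : l2norm (0 : 'cV[V]_k) = 0.
Proof. by rewrite /l2norm big1 ?sqrtr0 // => i _; rewrite mxE nrm0 expr0n. Qed.

Lemma nrm_le_l2norm (V : normedZmodType R[i]) k (h : 'cV[V]_k) i :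
  nrm (h i 0) <= l2norm h.
Proof.
rewrite -[leLHS](ger0_norm (nrm_ge0 _)) -sqrtr_sqr ler_wsqrtr //.
by rewrite (bigD1 i) //= lerDl sumr_ge0 // => j _; rewrite sqr_ge0.
Qed.

Lemma l2norm_le_sum (V : normedZmodType R[i]) k (h : 'cV[V]_k) :
  l2norm h <= \sum_i nrm (h i 0).
Proof.
have s0 : 0 <= \sum_i nrm (h i 0) by apply: sumr_ge0 => i _; exact: nrm_ge0.
rewrite -[leRHS](ger0_norm s0) -sqrtr_sqr ler_wsqrtr //.
rewrite [leRHS]expr2 big_distrl /=; apply: ler_sum => i _.
rewrite expr2 ler_wpM2l ?nrm_ge0 // (bigD1 i) //= lerDl.
by apply: sumr_ge0 => j _; exact: nrm_ge0.
Qed.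

Lemma nrm_sum (V : normedZmodType R[i]) k (h : 'I_k -> V) :
  nrm (\sum_i h i) <= \sum_i nrm (h i).
Proof.
elim/big_ind2: _ => [|x1 y1 x2 y2 h1 h2|//]; first by rewrite nrm0.
by apply: le_trans (nrmD _ _) _; exact: lerD.
Qed.

Lemma smxnorm_ub k (A : 'M[R[i]]_k) (v : 'cV[R[i]]_k) : l2norm v <= 1 ->
  l2norm (A *m v) <= \sum_i \sum_j nrm (A i j).
Proof.
move=> v1; apply: le_trans (l2norm_le_sum _) _; apply: ler_sum => i _.
rewrite mxE; apply: le_trans (nrm_sum _) _; apply: ler_sum => j _.
rewrite nrmM ler_piMr ?nrm_ge0 //.
by have h := nrm_le_l2norm v j; apply: le_trans h v1.
Qed.

Lemma smxnorm_has_sup k (A : 'M[R[i]]_k) :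
  has_sup [set l2norm (A *m v) | v in [set v : 'cV[R[i]]_k | l2norm v <= 1]].
Proof.
split; first by exists (l2norm (A *m 0)), 0 => //=; rewrite l2norm0.
by exists (\sum_i \sum_j nrm (A i j)) => _ [v /= v1 <-]; exact: smxnorm_ub.
Qed.

Lemma smxnorm_le_sum k (A : 'M[R[i]]_k) : smxnorm A <= \sum_i \sum_j nrm (A i j).
Proof.
apply: ge_sup; first by case: (smxnorm_has_sup A).
by move=> _ [v /= v1 <-]; exact: smxnorm_ub.
Qed.

Variable H : hilbertSpace R.

Lemma opmxnorm_ub k (a : 'M[bop H]_k) (h : 'cV[H]_k) : l2norm h <= 1 ->
  l2norm (\col_i \sum_j a i j (h j 0)) <= \sum_i \sum_j nrm (a i j).
Proof.
move=> h1; apply: le_trans (l2norm_le_sum _) _; apply: ler_sum => i _.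
rewrite mxE; apply: le_trans (nrm_sum _) _; apply: ler_sum => j _.
apply: le_trans (opnormP _ _) _.
by rewrite ler_piMr ?opnorm_ge0 //; apply: le_trans (nrm_le_l2norm h j) h1.
Qed.

Lemma opmxnorm_has_sup k (a : 'M[bop H]_k) :
  has_sup [set l2norm (\col_i \sum_j a i j (h j 0)) |
           h in [set h : 'cV[H]_k | l2norm h <= 1]].
Proof.
split; first by eexists; exists 0 => //=; rewrite l2norm0.
by exists (\sum_i \sum_j nrm (a i j)) => _ [v /= v1 <-]; exact: opmxnorm_ub.
Qed.

Lemma opmxnorm_le_sum k (a : 'M[bop H]_k) :
  opmxnorm a <= \sum_i \sum_j nrm (a i j).
Proof.
apply: ge_sup; first by case: (opmxnorm_has_sup a).
by move=> _ [v /= v1 <-]; exact: opmxnorm_ub.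
Qed.

Lemma opmxnorm1 (a : bop H) : opmxnorm (const_mx a : 'M[bop H]_1) = nrm a.
Proof.
rewrite /opmxnorm nrm_bop /opnorm; congr sup.
have e (h : 'cV[H]_1) : l2norm h = nrm (h 0 0).
  by rewrite /l2norm big_ord1 sqrtr_sqr ger0_norm ?nrm_ge0.
apply/seteqP; split => _ [h /= h1 <-].
  by exists (h 0 0); rewrite -?e // e mxE big_ord1 mxE.
by exists (const_mx h); rewrite /= e mxE // big_ord1 !mxE.
Qed.

End matrix_norms.

Section operator_spaces.
Variable R : realType.

(* A complex vector space with a number attached to each matrix over it;
   [is_opSpace] says that these are the norms of a closed subspace of a [B(H)]. *)
Record opStruct := OpStruct {
  carrier :> lmodType R[i];
  mxnorm : forall k, 'M[carrier]_k -> R }.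

Definition is_opSpace (E : opStruct) :=
  exists (H : hilbertSpace R) (j : {linear E -> bop H}),
    [/\ injective j, closed (range j)
      & forall k (x : 'M[E]_k), mxnorm x = opmxnorm (map_mx j x)].

Record opSpace := OpSpace {
  opSpace_struct :> opStruct;
  opSpaceP : is_opSpace opSpace_struct }.

Definition osnorm (E : opStruct) (x : E) : R := mxnorm (const_mx x : 'M[E]_1).

(* complete boundedness of a linear map with domain the subspace [A] *)
Definition cb_on (E F : opStruct) (A : set E) (T : E -> F) :=
  exists M : R, forall k (x : 'M[E]_k), (forall i j, A (x i j)) ->
    mxnorm (map_mx T x) <= M * mxnorm x.

Definition completely_bounded (E F : opStruct) (T : E -> F) := cb_on setT T.

Definition completely_isomorphic (E F : opStruct) :=
  exists (T : {linear E -> F}) (S : {linear F -> E}),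
    [/\ cancel T S, cancel S T, completely_bounded T & completely_bounded S].

Definition completely_embeds (E F : opStruct) :=
  exists T : {linear E -> F},
    [/\ injective T, completely_bounded T
      & exists2 S : F -> E, cancel T S & cb_on (range T) S].

End operator_spaces.

Section min_max.
Variables (R : realType) (E : completeNormedModType R[i]).

(* [M_k(C(K))] carries the norm of [C(K, M_k)]; here [K] is the unit ball of the
   dual of [E]. *)
Definition MIN : opStruct R := @OpStruct R E (fun k x =>
  sup [set smxnorm (map_mx f x) |
       f in [set f : {scalar E} | forall v, `|f v| <= `|v|]]).

Definition MAX : opStruct R := @OpStruct R E (fun k x =>
  sup [set r | exists (H : hilbertSpace R) (u : {linear E -> bop H}),
         (forall v, `|u v| <= `|v|) /\ r = opmxnorm (map_mx u x)]).

End min_max.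

Section ell2.
Variable R : realType.

Lemma nneg_series_cvg (f : nat -> R) (M : R) : (forall n, 0 <= f n) ->
  (forall n, series f n <= M) -> cvgn (series f).
Proof.
move=> f0 fM; apply: nondecreasing_is_cvgn.
  by apply: nondecreasing_series => n _ _; exact: f0.
by exists M => _ [n _ <-].
Qed.

Lemma nneg_series_le (f : nat -> R) n : (forall n, 0 <= f n) ->
  cvgn (series f) -> series f n <= limn (series f).
Proof.
move=> f0 cf; apply: nondecreasing_cvgn_le => //.
by apply: nondecreasing_series => m _ _; exact: f0.
Qed.

Definition square_summable : {pred nat -> R[i]} :=
  [pred x | `[< cvgn (series (fun n => nrm (x n) ^+ 2)) >]].

Record ell2 := Ell2 { ell2_fun :> nat -> R[i]; _ : ell2_fun \in square_summable }.

HB.instance Definition _ := [isSub for ell2_fun].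
HB.instance Definition _ := [Choice of ell2 by <:].

Lemma ell2P (x : ell2) : cvgn (series (fun n => nrm (x n) ^+ 2)).
Proof. by case: x => x /= /asboolP. Qed.

Arguments ell2P : clear implicits.

Let sq (x : nat -> R[i]) n := \sum_(0 <= i < n) nrm (x i) ^+ 2.

Let sqD x y n (A B : R) : 0 < A -> 0 < B -> sq x n <= A ^+ 2 -> sq y n <= B ^+ 2 ->
  sq (x + y) n <= (A + B) ^+ 2.
Proof.
move=> A0 B0 xA yB.
have pt (a b : R) : 0 <= a -> 0 <= b ->
    (a + b) ^+ 2 <= (A + B) / A * a ^+ 2 + (A + B) / B * b ^+ 2.
  move=> a0 b0; rewrite -subr_ge0.
  rewrite [X in 0 <= X](_ : _ = (B * a - A * b) ^+ 2 / (A * B)).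
    by rewrite divr_ge0 ?sqr_ge0 // mulr_ge0 // ltW.
  by field; rewrite !lt0r_neq0.
apply: (@le_trans _ _ ((A + B) / A * sq x n + (A + B) / B * sq y n)).
  rewrite /sq !mulr_sumr -big_split /=; apply: ler_sum => i _.
  apply: le_trans (pt _ _ (nrm_ge0 _) (nrm_ge0 _)).
  by rewrite ler_pXn2r ?nnegrE ?addr_ge0 ?nrm_ge0 // nrmD.
apply: (@le_trans _ _ ((A + B) / A * A ^+ 2 + (A + B) / B * B ^+ 2)).
  by apply: lerD; apply: ler_wpM2l => //; rewrite divr_ge0 ?addr_ge0 // ltW.
rewrite le_eqVlt; apply/orP; left; apply/eqP; field.
by rewrite !lt0r_neq0.
Qed.

Let sqZ k x n : sq (k *: x) n = nrm k ^+ 2 * sq x n.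
Proof.
by rewrite /sq mulr_sumr; apply: eq_bigr => i _; rewrite scalrfctE nrmM exprMn.
Qed.

Let sq0 (x : nat -> R[i]) n : 0 <= nrm (x n) ^+ 2.
Proof. exact: sqr_ge0. Qed.

Lemma square_summable_bounded (x : nat -> R[i]) (M : R) :
  (forall n, \sum_(0 <= i < n) nrm (x i) ^+ 2 <= M) -> x \in square_summable.
Proof. by move=> h; apply/asboolP; apply: nneg_series_cvg (sq0 _) h. Qed.

Lemma square_summable_closed : submod_closed square_summable.
Proof.
split.
  apply: (@square_summable_bounded _ 0) => n; rewrite big1 // => i _.
  by rewrite nrm0 expr0n.
move=> k x y /asboolP cx /asboolP cy.
pose A := Num.sqrt (limn (series (fun n => nrm (x n) ^+ 2))).
pose B := Num.sqrt (limn (series (fun n => nrm (y n) ^+ 2))).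
have lim0 (z : nat -> R[i]) : cvgn (series (fun n => nrm (z n) ^+ 2)) ->
    0 <= limn (series (fun n => nrm (z n) ^+ 2)).
  by move=> cz; have := nneg_series_le 0 (sq0 z) cz; rewrite seriesEnat /= big_geq.
have aux (z : nat -> R[i]) n : cvgn (series (fun n => nrm (z n) ^+ 2)) ->
    sq z n <= (Num.sqrt (limn (series (fun n => nrm (z n) ^+ 2))) + 1) ^+ 2.
  move=> cz; apply: le_trans (nneg_series_le n (sq0 z) cz) _.
  rewrite -[leLHS](sqr_sqrtr (lim0 _ cz)) ler_pXn2r ?nnegrE ?addr_ge0 ?sqrtr_ge0 //.
  by rewrite lerDl.
apply: (@square_summable_bounded _ ((nrm k * (A + 1) + 1 + (B + 1)) ^+ 2)) => n.
apply: sqD; last exact: aux.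
- by rewrite ltr_pwDr // mulr_ge0 ?nrm_ge0 // addr_ge0 ?sqrtr_ge0.
- by rewrite ltr_pwDr // sqrtr_ge0.
rewrite sqZ; apply: (@le_trans _ _ (nrm k ^+ 2 * (A + 1) ^+ 2)).
  by apply: ler_wpM2l; [exact: sqr_ge0|exact: aux].
rewrite -exprMn ler_pXn2r ?nnegrE ?addr_ge0 ?mulr_ge0 ?addr_ge0 ?nrm_ge0 ?sqrtr_ge0 //.
by rewrite lerDl.
Qed.

HB.instance Definition _ := GRing.isSubmodClosed.Build _ _ _ square_summable_closed.
HB.instance Definition _ := [SubChoice_isSubLmodule of ell2 by <:].

Definition ell2norm (x : ell2) : R :=
  Num.sqrt (limn (series (fun n => nrm (x n) ^+ 2))).

Lemma ell2norm_ge0 x : 0 <= ell2norm x. Proof. exact: sqrtr_ge0. Qed.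

Lemma ell2norm_sqr x : ell2norm x ^+ 2 = limn (series (fun n => nrm (x n) ^+ 2)).
Proof.
rewrite sqr_sqrtr //; have := nneg_series_le 0 (sq0 x) (ell2P x).
by rewrite seriesEnat /= big_geq.
Qed.

Lemma ell2norm_ub (x : ell2) n :
  \sum_(0 <= i < n) nrm (x i) ^+ 2 <= ell2norm x ^+ 2.
Proof. by rewrite ell2norm_sqr; apply: nneg_series_le (ell2P x). Qed.

Lemma ell2norm_le (x : ell2) (M : R) : 0 <= M ->
  (forall n, \sum_(0 <= i < n) nrm (x i) ^+ 2 <= M ^+ 2) -> ell2norm x <= M.
Proof.
move=> M0 h; rewrite -(@ler_pXn2r _ 2) ?nnegrE ?ell2norm_ge0 //.
by rewrite ell2norm_sqr; apply: limr_le (ell2P x) _; apply: nearW => n; exact: h.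
Qed.

Lemma nrm_le_ell2norm (x : ell2) n : nrm (x n) <= ell2norm x.
Proof.
rewrite -(@ler_pXn2r _ 2) ?nnegrE ?ell2norm_ge0 ?nrm_ge0 //.
apply: le_trans (ell2norm_ub x n.+1).
by rewrite big_nat_recr //= lerDr sumr_ge0.
Qed.

Let norm (x : ell2) : R[i] := (ell2norm x)%:C.

Let normD x y : norm (x + y) <= norm x + norm y.
Proof.
rewrite /norm -rmorphD /= lecR; apply/ler_addgt0Pr => e e0.
pose d := e / 2; have d0 : 0 < d by rewrite divr_gt0.
have -> : ell2norm x + ell2norm y + e = (ell2norm x + d) + (ell2norm y + d).
  by rewrite /d; field.
have aux (z : ell2) n : sq z n <= (ell2norm z + d) ^+ 2.
  apply: le_trans (ell2norm_ub z n) _.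
  rewrite ler_pXn2r ?nnegrE ?addr_ge0 ?ell2norm_ge0 ?(ltW d0) //.
  by rewrite lerDl ltW.
apply: ell2norm_le; first by rewrite !addr_ge0 ?ell2norm_ge0 // ltW.
by move=> n; apply: sqD => //; rewrite ltr_wpDl ?ell2norm_ge0.
Qed.

Let normZ k x : norm (k *: x) = `|k| * norm x.
Proof.
rewrite /norm nrmE -rmorphM /=; congr (_%:C).
apply/eqP; rewrite -(@eqrXn2 _ 2) ?mulr_ge0 ?nrm_ge0 ?ell2norm_ge0 //.
apply/eqP; rewrite exprMn !ell2norm_sqr.
have -> : (fun n => nrm ((k *: x) n) ^+ 2) =
    nrm k ^+ 2 *: (fun n => nrm (x n) ^+ 2) :> (nat -> R).
  by apply/funext => n; rewrite scalrfctE /= /GRing.scale /= nrmM exprMn.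
by rewrite lim_seriesZ //; exact: ell2P.
Qed.

Let norm0_eq0 x : norm x = 0 -> x = 0.
Proof.
move=> /complexI x0; apply/val_inj/funext => n /=; apply/nrm0_eq0/eqP.
by rewrite eq_le nrm_ge0 andbT -x0 nrm_le_ell2norm.
Qed.

HB.instance Definition _ := Lmodule_isNormed.Build R[i] ell2 normD normZ norm0_eq0.

Lemma nrm_ell2 (x : ell2) : nrm x = ell2norm x.
Proof. by []. Qed.

End ell2.
Arguments ell2P {R} x.

Section ell2_hilbert.
Variable R : realType.
Implicit Types (x y z : ell2 R) (f g : nat -> R[i]).

Let ball_nrm x y (e : R) : ball x (e%:C) y <-> nrm (x - y) < e.
Proof. by rewrite -ball_normE /= nrmE ltcR. Qed.

Let nrm_sqrB (a b : R[i]) : nrm (a - b) ^+ 2 =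
  (complex.Re a - complex.Re b) ^+ 2 + (complex.Im a - complex.Im b) ^+ 2.
Proof. by rewrite nrm_sqr; case: a => ? ?; case: b. Qed.

Let coord_cauchy (F : set_system (ell2 R)) (h : R[i] -> R) :
  ProperFilter F -> cauchy F -> (forall a b, `|h a - h b| <= nrm (a - b)) ->
  forall n, cvg ((fun x => h (x n)) @ F).
Proof.
move=> PF cF hl n; apply: R_complete; apply: cauchy_exP => e e0.
have e0' : 0 < e%:C by rewrite ltcR.
have [x Fx] : exists x, F (ball x e%:C) by move/cauchyP: cF; apply.
exists (h (x n)); suff: F [set y | `|h (x n) - h (y n)| < e] by [].
apply: filterS Fx => y /ball_nrm xy /=.
apply: (le_lt_trans (hl _ _)); apply: le_lt_trans xy.
by rewrite nrm_ell2; exact: (nrm_le_ell2norm (x - y) n).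
Qed.

Let ell2_complete (F : set_system (ell2 R)) : ProperFilter F -> cauchy F -> cvg F.
Proof.
move=> PF cF; have cF' : cauchy_ex F by exact/cauchyP.
have cRe n : cvg ((fun x => complex.Re (x n)) @ F).
  apply: coord_cauchy => // a b; apply: le_trans (Re_le_nrm _).
  by case: a => ? ?; case: b.
have cIm n : cvg ((fun x => complex.Im (x n)) @ F).
  apply: coord_cauchy => // a b; apply: le_trans (Im_le_nrm _).
  by case: a => ? ?; case: b.
pose a n := lim ((fun x => complex.Re (x n)) @ F) +i*
            lim ((fun x => complex.Im (x n)) @ F).
have cvg_sqr (u : ell2 R -> R) (l : R) : u y @[y --> F] --> l ->
    u y ^+ 2 @[y --> F] --> l ^+ 2.
  by move=> ul; rewrite expr2; under eq_fun do rewrite expr2; exact: cvgM.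
have key x e : 0 < e -> F (ball x e%:C) ->
    forall n, \sum_(0 <= i < n) nrm (x i - a i) ^+ 2 <= e ^+ 2.
  move=> e0 Fx n.
  pose G y := \sum_(0 <= i < n) nrm (x i - y i) ^+ 2.
  have cG : G y @[y --> F] --> \sum_(0 <= i < n) nrm (x i - a i) ^+ 2.
    rewrite /G; apply: cvg_big => [|i _]; first exact: add_continuous.
    rewrite nrm_sqrB; under eq_fun do rewrite nrm_sqrB.
    apply: cvgD; apply: cvg_sqr; apply: cvgB;
      by [exact: cvg_cst|exact: cRe|exact: cIm].
  apply: (cvgr_to_le cG); apply: filterS Fx => y /ball_nrm xy.
  apply: le_trans (ell2norm_ub (x - y) n) _.
  by rewrite ler_pXn2r ?nnegrE ?ell2norm_ge0 ?(ltW e0) // -nrm_ell2 ltW.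
have [x0 Fx0] := cF' 1%:C ltr01.
have sa : a \in @square_summable R.
  have : (x0 : nat -> R[i]) - a \in @square_summable R.
    by apply: (square_summable_bounded (M := 1 ^+ 2)) => n; exact: key.
  have : (x0 : nat -> R[i]) \in @square_summable R by exact: valP.
  by move=> h1 h2; rewrite -(subKr (x0 : nat -> R[i]) a) rpredB.
apply/cvg_ex; exists (Ell2 sa); apply/cvgrPdist_lt => e e0.
have [r r0 rE] : exists2 r : R, 0 < r & e = r%:C.
  case: e e0 => u v; rewrite ltcE /= => /andP[/eqP -> u0]; by exists u.
have r20 : 0 < r / 2 by rewrite divr_gt0.
have r20' : 0 < (r / 2)%:C by rewrite ltcR.
have [x Fx] := cF' _ r20'.
apply: filterS (Fx) => y /ball_nrm xy.
rewrite rE nrmE ltcR -(subrK x (Ell2 sa)) -addrA.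
apply: le_lt_trans (nrmD _ _) _; rewrite [ltRHS](splitr r).
apply: ler_ltD xy; rewrite -nrmN opprB nrm_ell2.
by apply: ell2norm_le; [exact: ltW|move=> n; exact: key].
Qed.

HB.instance Definition _ := Uniform_isComplete.Build (ell2 R) ell2_complete.

Let absum f := cvgn (series (fun n => nrm (f n))).

(* the sum of an absolutely convergent complex series *)
Definition csum f : R[i] :=
  limn (series (fun n => complex.Re (f n))) +i*
  limn (series (fun n => complex.Im (f n))).

Let cRe f : absum f -> cvgn (series (fun n => complex.Re (f n))).
Proof.
move=> cf; apply: normed_cvg; apply: series_le_cvg cf => n /=.
- exact: normr_ge0.
- exact: nrm_ge0.
- exact: Re_le_nrm.
Qed.

Let cIm f : absum f -> cvgn (series (fun n => complex.Im (f n))).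
Proof.
move=> cf; apply: normed_cvg; apply: series_le_cvg cf => n /=.
- exact: normr_ge0.
- exact: nrm_ge0.
- exact: Im_le_nrm.
Qed.

Let csumP f g k : absum f -> absum g ->
  csum (fun n => k * f n + g n) = k * csum f + csum g.
Proof.
move=> cf cg; case: k => u v; rewrite /csum.
have -> : (fun n => complex.Re ((u +i* v) * f n + g n)) =
    u *: (fun n => complex.Re (f n)) + ((- v) *: (fun n => complex.Im (f n)) +
    (fun n => complex.Re (g n))) :> (nat -> R).
  apply/funext => n; rewrite !addrfctE !scalrfctE /GRing.scale /=.
  by case: (f n) => ? ?; case: (g n) => ? ? /=; rewrite mulNr addrA.
have -> : (fun n => complex.Im ((u +i* v) * f n + g n)) =
    u *: (fun n => complex.Im (f n)) + (v *: (fun n => complex.Re (f n)) +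
    (fun n => complex.Im (g n))) :> (nat -> R).
  apply/funext => n; rewrite !addrfctE !scalrfctE /GRing.scale /=.
  by case: (f n) => ? ?; case: (g n) => ? ? /=; rewrite addrA.
have f1 := cRe cf; have f2 := cIm cf; have g1 := cRe cg; have g2 := cIm cg.
rewrite (lim_seriesD (is_cvg_seriesZ (k := u) f1)
  (is_cvg_seriesD (is_cvg_seriesZ (k := (- v)) f2) g1)).
rewrite (lim_seriesD (is_cvg_seriesZ (k := (- v)) f2) g1).
rewrite (lim_seriesD (is_cvg_seriesZ (k := u) f2)
  (is_cvg_seriesD (is_cvg_seriesZ (k := v) f1) g2)).
rewrite (lim_seriesD (is_cvg_seriesZ (k := v) f1) g2).
rewrite (lim_seriesZ u f1) (lim_seriesZ v f1) (lim_seriesZ u f2) (lim_seriesZ (- v) f2).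
apply/eqP; rewrite eq_complex /=; apply/andP; split; apply/eqP;
  by rewrite /GRing.scale /=; ring.
Qed.

Definition ell2_inner x y : R[i] := csum (fun n => x n * Num.conj (y n)).

Let absum_inner x y : absum (fun n => x n * Num.conj (y n)).
Proof.
have c := is_cvg_seriesD (ell2P x) (ell2P y).
apply: series_le_cvg c => n; rewrite ?addrfctE ?addr_ge0 ?nrm_ge0 ?sqr_ge0 //.
rewrite nrmM nrm_conj.
by nra.
Qed.

Let inner_linearl z : linear_for *%R (ell2_inner^~ z).
Proof.
move=> k x y; rewrite /ell2_inner -csumP; try exact: absum_inner.
by congr csum; apply/funext => n; rewrite mulrA -mulrDl.
Qed.

Let inner_conj x y : ell2_inner x y = (-1) ^+ false * Num.conj (ell2_inner y x).
Proof.
rewrite expr0 mul1r /ell2_inner /csum.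
have -> : (fun n => complex.Re (x n * Num.conj (y n))) =
    (fun n => complex.Re (y n * Num.conj (x n))).
  by apply/funext => n; case: (x n) => ? ?; case: (y n) => ? ? /=; ring.
have -> : (fun n => complex.Im (x n * Num.conj (y n))) =
    - (fun n => complex.Im (y n * Num.conj (x n))) :> (nat -> R).
  apply/funext => n; rewrite opprfctE.
  by case: (x n) => ? ?; case: (y n) => ? ? /=; ring.
by rewrite lim_seriesN //; apply: cIm; exact: absum_inner.
Qed.

Let inner_linearr x : linear_for (Num.conj \; *%R) (ell2_inner x).
Proof.
move=> k y z; rewrite ![ell2_inner x _]inner_conj inner_linearl.
by rewrite !expr0 !mul1r rmorphD rmorphM.
Qed.

HB.instance Definition _ := bilinear_isBilinear.Build R[i] (ell2 R) (ell2 R) R[i]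
  *%R (Num.conj \; *%R) ell2_inner (inner_linearl, inner_linearr).

HB.instance Definition _ :=
  isHermitianSesquilinear.Build R[i] (ell2 R) false Num.conj ell2_inner inner_conj.

Lemma ell2_innerE x : ell2_inner x x = `|x| ^+ 2.
Proof.
rewrite nrmE -rmorphXn /= nrm_ell2 ell2norm_sqr /ell2_inner /csum.
have -> : (fun n => complex.Re (x n * Num.conj (x n))) = (fun n => nrm (x n) ^+ 2).
  by apply/funext => n; rewrite nrm_sqr; case: (x n) => ? ? /=; ring.
have -> : (fun n => complex.Im (x n * Num.conj (x n))) = (fun n => 0).
  by apply/funext => n; case: (x n) => ? ? /=; ring.
have -> : limn (series (fun _ : nat => 0 : R)) = 0 => //.
rewrite (_ : series _ = fun=> 0) ?lim_cst //.
by apply/funext => n; rewrite /series /= big1.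
Qed.

Let inner_gt0 x : x != 0 -> 0 < ell2_inner x x.
Proof. by move=> x0; rewrite ell2_innerE exprn_gt0 // normr_gt0. Qed.

HB.instance Definition _ := isDotProduct.Build R[i] (ell2 R) ell2_inner inner_gt0.

Definition ell2H : hilbertSpace R := @HilbertSpace R (ell2 R) ell2_inner ell2_innerE.

End ell2_hilbert.

Section min_max_theory.
Variables (R : realType) (E : completeNormedModType R[i]).

Let linear0 : linear_for *%R (fun _ : E => 0 : R[i]).
Proof. by move=> k u v; rewrite mulr0 addr0. Qed.

Lemma MIN_has_sup k (x : 'M[E]_k) :
  has_sup [set smxnorm (map_mx f x) |
           f in [set f : {scalar E} | forall v, `|f v| <= `|v|]].
Proof.
pose z : {scalar E} := HB.pack (fun _ : E => 0 : R[i])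
  (GRing.isLinear.Build _ _ _ _ _ linear0).
split; first by eexists; exists z => //= v; rewrite normr0.
exists (\sum_i \sum_j nrm (x i j)) => _ [f /= f1 <-].
apply: le_trans (smxnorm_le_sum _) _.
by do 2!(apply: ler_sum => ? _); rewrite mxE -lecR -!nrmE.
Qed.

Lemma MAX_has_sup k (x : 'M[E]_k) :
  has_sup [set r | exists (H : hilbertSpace R) (u : {linear E -> bop H}),
             (forall v, `|u v| <= `|v|) /\ r = opmxnorm (map_mx u x)].
Proof.
pose H := ell2H R; split.
  exists (opmxnorm (map_mx (GRing.null_fun _ : {linear E -> bop H}) x)).
  exists H, (GRing.null_fun _ : {linear E -> bop H}); split => // v.
  by rewrite normr0.
exists (\sum_i \sum_j nrm (x i j)) => _ [K [u [u1 ->]]].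
apply: le_trans (opmxnorm_le_sum _) _.
by do 2!(apply: ler_sum => ? _); rewrite mxE -lecR -!nrmE.
Qed.

End min_max_theory.

Section rank_one.
Variables (R : realType) (H : hilbertSpace R).

Let innerC (u v : H) : inner u v = Num.conj (inner v u).
Proof. by rewrite (hermC inner u v) expr0 mul1r. Qed.

Lemma inner_CauchySchwarz (u v : H) : nrm (inner u v) <= nrm u * nrm v.
Proof.
have [->|v0] := eqVneq v 0; first by rewrite linear0r !nrm0 mulr0.
have vv0 : inner v v != 0 by rewrite innerE expf_neq0 // normr_eq0.
pose a := inner u v / inner v v; pose w := u - a *: v.
have ou : inner w v = 0.
  by rewrite linearBl linearZl_LR /= divfK ?subrr.
have uE : u = w + a *: v by rewrite subrK.
have e : inner u u = inner w w + `|a| ^+ 2 * inner v v.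
  have vw : inner v w = 0 by rewrite innerC ou rmorph0.
  have wu : inner w u = inner w w.
    by rewrite innerC {1}uE linearDl linearZl_LR /= vw mulr0 addr0 -innerC.
  have vu : inner v u = Num.conj a * inner v v.
    by rewrite innerC {1}uE linearDl linearZl_LR /= ou add0r rmorphM /= -innerC.
  by rewrite {1}uE linearDl linearZl_LR /= wu vu mulrA normCK.
have uv : inner u v = a * inner v v by rewrite divfK.
have h : `|inner u v| ^+ 2 <= (`|u| * `|v|) ^+ 2.
  rewrite uv normrM !exprMn -!innerE e.
  rewrite [`|inner v v|]ger0_norm; last by rewrite innerE exprn_ge0.
  rewrite mulrDl expr2 mulrA lerDr mulr_ge0 // innerE exprn_ge0 //.
move: h; rewrite ler_pXn2r ?nnegrE ?mulr_ge0 //.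
by rewrite !nrmE -rmorphM lecR.
Qed.

Let rank_one_bounded (x y : H) : (fun h => inner h y *: x) \in @bounded_op R H.
Proof.
have l : linear (fun h => inner h y *: x).
  by move=> k u v; rewrite linearDl /= linearZl_LR /= scalerDl scalerA.
apply/asboolP; split => //.
pose f : {linear H -> H} := HB.pack (fun h => inner h y *: x)
  (GRing.isLinear.Build _ _ _ _ _ l).
apply: (@bounded_linear_continuous _ _ _ f); apply/linear_boundedP.
near=> M => h; rewrite /f /= normrZ.
apply: (@le_trans _ _ (`|y| * `|x| * `|h|)); last first.
  by apply: ler_wpM2r => //; near: M; apply: nbhs_pinfty_ge; rewrite realM ?normr_real.
rewrite mulrAC; apply: ler_wpM2r => //.
by rewrite !nrmE -rmorphM lecR mulrC inner_CauchySchwarz.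
Unshelve. all: by end_near. Qed.

(* the operator [h |-> <h, y> x] *)
Definition rank_one (x y : H) : bop H := Bop (rank_one_bounded x y).

Lemma rank_oneE x y h : rank_one x y h = inner h y *: x.
Proof. by []. Qed.

Lemma nrm_rank_one x y : nrm (rank_one x y) = nrm x * nrm y.
Proof.
rewrite nrm_bop; apply/eqP; rewrite eq_le; apply/andP; split.
  apply: opnorm_le => h h1; rewrite rank_oneE nrmZ mulrC ler_wpM2l ?nrm_ge0 //.
  apply: le_trans (inner_CauchySchwarz _ _) _.
  by rewrite ler_piMl ?nrm_ge0.
have [->|y0] := eqVneq y 0; first by rewrite nrm0 mulr0 opnorm_ge0.
have ny0 : 0 < nrm y.
  by rewrite lt_neqAle nrm_ge0 eq_sym andbT; apply: contra y0 => /eqP/nrm0_eq0 ->.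
rewrite -(ler_pM2r ny0); apply: le_trans (opnormP _ _).
rewrite rank_oneE nrmZ innerE nrmE -rmorphXn nrm_real ?sqr_ge0 //=.
by rewrite mulrC mulrA mulrAC -expr2 mulrC.
Qed.

End rank_one.
Arguments rank_one {R H} x y.

Section closed_span.
Variables (R : realType) (V : normedModType R[i]) (A : set V).

Definition linear_span : set V := [set v | exists n (k : 'I_n -> R[i]) (a : 'I_n -> V),
  (forall i, A (a i)) /\ v = \sum_i k i *: a i].

Definition in_closed_span : {pred V} := [pred v | `[< closure linear_span v >]].

Record closed_span := ClosedSpan {
  closed_span_val :> V; _ : closed_span_val \in in_closed_span }.

HB.instance Definition _ := [isSub for closed_span_val].
HB.instance Definition _ := [Choice of closed_span by <:].

Lemma in_closed_spanP (v : V) : reflect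
  (forall e : R, 0 < e -> exists2 w, linear_span w & nrm (v - w) < e)
  (v \in in_closed_span).
Proof.
apply: (iffP (asboolP _)) => [cv e e0|h B].
  have e0' : 0 < e%:C by rewrite ltcR.
  have [w [Aw]] := cv _ (nbhsx_ballx v _ e0').
  by rewrite -ball_normE /= nrmE ltcR; exists w.
rewrite -nbhs_ballE => -[e /= e0 eB].
have [r r0 rE] : exists2 r : R, 0 < r & e = r%:C.
  by case: e e0 {eB} => s t; rewrite ltcE /= => /andP[/eqP -> s0]; exists s.
have [w Aw vw] := h _ r0; exists w; split => //; apply: eB.
by rewrite -ball_normE /= rE nrmE ltcR.
Qed.

Lemma linear_spanP k v w : linear_span v -> linear_span w -> linear_span (k *: v + w).
Proof.
move=> [n [c [a [Aa ->]]]] [m [d [b [Ab ->]]]].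
exists (n + m)%N, (fun i => match fintype.split i with inl j => k * c j | inr j => d j end),
  (fun i => match fintype.split i with inl j => a j | inr j => b j end).
split; first by move=> i; case: fintype.split.
rewrite big_split_ord /= scaler_sumr; congr (_ + _); apply: eq_bigr => i _.
  by rewrite (unsplitK (inl i)) scalerA.
by rewrite (unsplitK (inr i)).
Qed.

Lemma in_closed_span_closed : submod_closed in_closed_span.
Proof.
split.
  apply/in_closed_spanP => e e0; exists 0; last by rewrite subrr nrm0.
  exists 0%N, (fun=> 0), (fun=> 0); split; first by case.
  by rewrite big_ord0.
move=> k v w /in_closed_spanP cv /in_closed_spanP cw; apply/in_closed_spanP => e e0.
have k1 : 0 < nrm k + 1 by rewrite ltr_wpDl ?nrm_ge0.
have e2 : 0 < e / 2 by rewrite divr_gt0.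
have ek : 0 < e / 2 / (nrm k + 1) by rewrite divr_gt0.
have [v' Av' vv'] := cv _ ek; have [w' Aw' ww'] := cw _ e2.
exists (k *: v' + w'); first exact: linear_spanP.
rewrite opprD addrACA -scalerBr; apply: le_lt_trans (nrmD _ _) _.
rewrite [ltRHS](splitr e); apply: ler_ltD ww'.
rewrite nrmZ; move: vv'; rewrite ltr_pdivlMr // => /ltW; apply: le_trans.
by rewrite mulrC ler_wpM2l ?nrm_ge0 // lerDl.
Qed.

HB.instance Definition _ :=
  GRing.isSubmodClosed.Build _ _ in_closed_span in_closed_span_closed.
HB.instance Definition _ := [SubChoice_isSubLmodule of closed_span by <:].

End closed_span.

Definition closed_span_os (R : realType) (H : hilbertSpace R) (A : set (bop H)) :
    opStruct R :=
  @OpStruct R (closed_span A) (fun k x => opmxnorm (map_mx (@closed_span_val _ _ A) x)).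

Lemma closed_span_opSpace (R : realType) (H : hilbertSpace R) (A : set (bop H)) :
  is_opSpace (closed_span_os A).
Proof.
exists H, (\val : {linear closed_span A -> bop H}); split => //.
rewrite [X in closed X](_ : _ = closure (linear_span A)).
  exact: closed_closure.
apply/seteqP; split => [_ [x _ <-]|v cv].
  by case: x => x /= /asboolP.
have cv' : v \in in_closed_span A by apply/asboolP.
by exists (ClosedSpan cv').
Qed.

Section row_column.
Variable R : realType.
Local Notation ell2 := (ell2 R).
Local Notation H := (ell2H R).

Let unit_summable i : (fun n => (n == i)%:R) \in @square_summable R.
Proof.
apply: (@square_summable_bounded _ _ 1) => n.
have [ni|ni] := leqP n i.
  rewrite big_nat big1 // => j /andP[_ ji].
  by rewrite ltn_eqF ?nrm0 ?expr0n // (leq_trans ji).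
rewrite (big_cat_nat (leq0n i) (ltnW ni)) /= big_nat_cond big1; last first.
  by move=> j /andP[/andP[_ ji] _]; rewrite ltn_eqF // nrm0 expr0n.
rewrite add0r big_ltn // eqxx (nrm_real ler01) expr1n.
rewrite big_nat_cond big1 ?addr0 //.
by move=> j /andP[/andP[ij _] _]; rewrite gtn_eqF // nrm0 expr0n.
Qed.

(* Indices start at 0: the first basis vector is [ell2_unit 0]. *)
Definition ell2_unit i : ell2 := Ell2 (unit_summable i).

Definition matrix_unit i j : bop H := rank_one (ell2_unit i : H) (ell2_unit j : H).

Let csum_single (f : nat -> R[i]) i : (forall n, n != i -> f n = 0) -> csum f = f i.
Proof.
move=> fi.
have aux (h : R[i] -> R) : h 0 = 0 -> limn (series (fun n => h (f n))) = h (f i).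
  move=> h0; apply/cvg_lim => //; apply: cvg_near_cst.
  exists i.+1 => // n /= ni; rewrite seriesEnat /=.
  rewrite (big_cat_nat (leq0n i) (ltnW ni)) /= big_nat_cond big1; last first.
    by move=> j /andP[/andP[_ ji] _]; rewrite fi ?h0 // ltn_eqF.
  rewrite add0r big_ltn // big_nat_cond big1 ?addr0 //.
  by move=> j /andP[/andP[ij _] _]; rewrite fi ?h0 // gtn_eqF.
by rewrite /csum !aux //; case: (f i).
Qed.

Lemma inner_unit (h : ell2) j : ell2_inner h (ell2_unit j) = h j.
Proof.
rewrite /ell2_inner (@csum_single _ j) /=; last first.
  by move=> n /negPf ->; rewrite rmorph0 mulr0.
by rewrite eqxx rmorph1 mulr1.
Qed.

Lemma matrix_unitE i j (h : ell2) : matrix_unit i j h = h j *: ell2_unit i.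
Proof. by rewrite rank_oneE [inner _ _]inner_unit. Qed.

Definition row_space : opStruct R :=
  closed_span_os (range (fun i => matrix_unit 0 i)).

Definition column_space : opStruct R :=
  closed_span_os (range (fun i => matrix_unit i 0)).

Let conj_summable (x : ell2) : (fun n => Num.conj (x n)) \in @square_summable R.
Proof.
apply/asboolP; rewrite [X in series X](_ : _ = fun n => nrm (x n) ^+ 2).
  exact: ell2P.
by apply/funext => n; rewrite nrm_conj.
Qed.

Definition ell2_conj (x : ell2) : ell2 := Ell2 (conj_summable x).

(* [h |-> (\sum_i x_i h_i) e_0] *)
Definition row_op (x : ell2) : bop H :=
  rank_one (ell2_unit 0 : H) (ell2_conj x : H).

(* [h |-> h_0 x] *)
Definition column_op (x : ell2) : bop H := rank_one (x : H) (ell2_unit 0 : H).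

Lemma row_opE (x h : ell2) :
  row_op x h = csum (fun i => x i * h i) *: ell2_unit 0.
Proof.
rewrite rank_oneE; congr (_ *: _); congr csum; apply/funext => n /=.
by rewrite conjCK mulrC.
Qed.

Lemma column_opE (x h : ell2) : column_op x h = h 0%N *: x.
Proof. by rewrite rank_oneE [inner _ _]inner_unit. Qed.

Lemma row_op_unit i : row_op (ell2_unit i) = matrix_unit 0 i.
Proof.
rewrite /row_op /matrix_unit; congr rank_one; apply/val_inj/funext => n /=.
by case: eqP; rewrite ?rmorph0 ?rmorph1.
Qed.

Lemma column_op_unit i : column_op (ell2_unit i) = matrix_unit i 0.
Proof. by []. Qed.

Let nrm_unit i : nrm (ell2_unit i) = 1.
Proof.
have : inner (ell2_unit i : H) (ell2_unit i : H) = 1.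
  by rewrite [inner _ _]inner_unit /= eqxx.
rewrite innerE nrmE -rmorphXn => /complexI /eqP.
by rewrite sqrp_eq1 ?nrm_ge0 // => /eqP.
Qed.

Lemma nrm_row_op x : nrm (row_op x) = nrm x.
Proof.
rewrite nrm_rank_one nrm_unit mul1r !nrm_ell2 /ell2norm; congr (Num.sqrt (limn _)).
by congr series; apply/funext => n /=; rewrite nrm_conj.
Qed.

Lemma nrm_column_op x : nrm (column_op x) = nrm x.
Proof. by rewrite nrm_rank_one nrm_unit mulr1. Qed.

Lemma row_op_linear : linear row_op.
Proof.
move=> k x y; apply/val_inj/funext => h.
change (row_op (k *: x + y) h = k *: row_op x h + row_op y h).
rewrite /row_op !rank_oneE.
have -> : ell2_conj (k *: x + y) = Num.conj k *: ell2_conj x + ell2_conj y.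
  apply/val_inj/funext => n.
  change (Num.conj (k * x n + y n) = Num.conj k * Num.conj (x n) + Num.conj (y n)).
  by rewrite rmorphD rmorphM.
by rewrite linearDr linearZr_LR /= conjCK scalerDl scalerA.
Qed.

Lemma column_op_linear : linear column_op.
Proof.
move=> k x y; apply/val_inj/funext => h.
change (column_op (k *: x + y) h = k *: column_op x h + column_op y h).
by rewrite /column_op !rank_oneE scalerDr !scalerA mulrC.
Qed.

Let trunc (x : ell2) N : ell2 := \sum_(i < N) x i *: ell2_unit i.

Let truncE x N n : trunc x N n = if (n < N)%N then x n else 0.
Proof.
have -> : trunc x N n = \sum_(i < N) x i * (n == i)%:R.
  rewrite /trunc; elim/big_rec2: _ => //= i u v _ <-.
  by rewrite addrfctE scalrfctE.
case: ifPn => nN; last first.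
  rewrite big1 // => i _; rewrite gtn_eqF ?mulr0 //.
  by apply: leq_trans (ltn_ord i) _; rewrite leqNgt.
rewrite (bigD1 (Ordinal nN)) //= eqxx mulr1 big1 ?addr0 // => i ni.
rewrite (_ : (n == i) = false) ?mulr0 //.
by apply/negbTE; apply: contraNneq ni => ni; apply/eqP/val_inj; rewrite /= ni.
Qed.

Let trunc_cvg x (e : R) : 0 < e -> exists N, nrm (x - trunc x N) < e.
Proof.
move=> e0; pose s := series (fun n => nrm (x n) ^+ 2).
have d0 : 0 < (e / 2) ^+ 2 by rewrite exprn_gt0 // divr_gt0.
have /cvgrPdist_lt/(_ _ d0)[N _ hN] := ell2P x.
exists N; rewrite nrm_ell2; apply: (@le_lt_trans _ _ (e / 2)); last first.
  by rewrite ltr_pdivrMr // ltr_pMr // ltr1n.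
apply: ell2norm_le => [|n]; first by rewrite divr_ge0 // ltW.
have e1 i : nrm ((x - trunc x N) i) ^+ 2 = if (i < N)%N then 0 else nrm (x i) ^+ 2.
  rewrite [(x - trunc x N) i](_ : _ = x i - trunc x N i) // truncE.
  by case: ifP; rewrite ?subrr ?nrm0 ?expr0n // subr0.
under eq_bigr do rewrite e1.
have sn : s (maxn n N) <= limn s.
  by apply: nneg_series_le (ell2P x) => m; exact: sqr_ge0.
have := hN N (leqnn N); rewrite -/s => /ltW/(le_trans (ler_norm _)); apply: le_trans.
rewrite lerBrDr; apply: le_trans sn.
rewrite /s !seriesEnat /=.
apply: (@le_trans _ _ (\sum_(0 <= i < maxn n N) (if (i < N)%N then 0 else nrm (x i) ^+ 2) +
   \sum_(0 <= i < N) nrm (x i) ^+ 2)).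
  rewrite lerD2r [leRHS](big_cat_nat (leq0n n) (leq_maxl n N)) /= lerDl.
  by apply: sumr_ge0 => i _; case: ifP => // _; exact: sqr_ge0.
rewrite !(@big_cat_nat _ _ _ N 0%N (maxn n N)) ?leq_maxr //=.
rewrite [X in X + _ + _ <= _]big_nat_cond big1 ?add0r; last first.
  by move=> i /andP[/andP[_ ->]].
rewrite [leLHS]addrC lerD2l [leLHS]big_nat_cond [leRHS]big_nat_cond.
by apply: ler_sum => i /andP[/andP[Ni _] _]; rewrite ltnNge Ni.
Qed.

Let op_in_span (T : ell2 -> bop H) (m : nat -> bop H) : linear T ->
  (forall x, nrm (T x) = nrm x) -> (forall i, T (ell2_unit i) = m i) ->
  forall x, T x \in in_closed_span (range m).
Proof.
move=> lT nT Tm x; apply/in_closed_spanP => e e0.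
pose T' : {linear ell2 -> bop H} := HB.pack T (GRing.isLinear.Build _ _ _ _ _ lT).
have [N xN] := trunc_cvg x e0; exists (T (trunc x N)).
  exists N, (fun i => x i), (fun i => m i); split; first by move=> i; exists i.
  rewrite -[T]/(T' : _ -> _) /trunc linear_sum; apply: eq_bigr => i _.
  by rewrite linearZ_LR -Tm.
by rewrite -[T]/(T' : _ -> _) -linearB [nrm _]nT.
Qed.

Definition row_map (x : ell2) : row_space :=
  ClosedSpan (op_in_span row_op_linear nrm_row_op row_op_unit x).

Definition column_map (x : ell2) : column_space :=
  ClosedSpan (op_in_span column_op_linear nrm_column_op column_op_unit x).

End row_column.

Definition sum_infty (R : realType) (E F : opStruct R) : opStruct R :=
  @OpStruct R (E * F)%type (fun k x =>
    Num.max (mxnorm (map_mx fst x)) (mxnorm (map_mx snd x))).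

Definition row_cap_column (R : realType) : opStruct R :=
  @OpStruct R (ell2 R) (fun k x =>
    mxnorm (map_mx (fun v => (row_map v, column_map v)) x
            : 'M[sum_infty (row_space R) (column_space R)]_k)).

Section c0_sum.
Variables (R : realType) (Y : nat -> opSpace R).

Lemma osnormE (E : opSpace R) : exists (H : hilbertSpace R) (j : {linear E -> bop H}),
  forall x, osnorm x = nrm (j x).
Proof.
have [H [j [_ _ jE]]] := opSpaceP E; exists H, j => x.
rewrite /osnorm jE -opmxnorm1; congr opmxnorm.
by apply/matrixP => i1 i2; rewrite !mxE.
Qed.

Lemma osnorm_ge0 (E : opSpace R) (x : E) : 0 <= osnorm x.
Proof. by have [H [j ->]] := osnormE E; exact: nrm_ge0. Qed.

Lemma osnorm0 (E : opSpace R) : osnorm (0 : E) = 0.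
Proof. by have [H [j ->]] := osnormE E; rewrite linear0 nrm0. Qed.

Lemma osnormD (E : opSpace R) (x y : E) : osnorm (x + y) <= osnorm x + osnorm y.
Proof. by have [H [j jE]] := osnormE E; rewrite !jE linearD nrmD. Qed.

Lemma osnormZ (E : opSpace R) (k : R[i]) (x : E) : osnorm (k *: x) = nrm k * osnorm x.
Proof. by have [H [j jE]] := osnormE E; rewrite !jE linearZ nrmZ. Qed.

Lemma mxnorm_le_sum (E : opSpace R) k (x : 'M[E]_k) :
  mxnorm x <= \sum_i \sum_j osnorm (x i j).
Proof.
have [H [j [_ _ jE]]] := opSpaceP E; rewrite jE.
apply: le_trans (opmxnorm_le_sum _) _.
apply: ler_sum => i1 _; apply: ler_sum => i2 _.
rewrite mxE /osnorm jE -opmxnorm1 le_eqVlt; apply/orP; left; apply/eqP.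
by congr opmxnorm; apply/matrixP => ? ?; rewrite !mxE.
Qed.

Record c0_seq := C0Seq {
  c0_fun :> forall n, Y n;
  c0_cvg : osnorm (c0_fun n) @[n --> \oo] --> 0 }.

HB.instance Definition _ := gen_eqMixin c0_seq.
HB.instance Definition _ := gen_choiceMixin c0_seq.

Lemma c0_ext (x y : c0_seq) : (forall n, x n = y n) -> x = y.
Proof.
case: x y => [x cx] [y cy] /= xy.
have e : x = y by apply: functional_extensionality_dep.
by subst y; congr C0Seq; exact: Prop_irrelevance.
Qed.

Let cvg0 (u v : nat -> R) : (forall n, 0 <= u n <= v n) ->
  v n @[n --> \oo] --> 0 -> u n @[n --> \oo] --> 0.
Proof. by move=> uv v0; apply: squeeze_cvgr (@cvg_cst _ _ _ _ _) v0; exact: nearW. Qed.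

Let zero_cvg : osnorm (0 : Y n) @[n --> \oo] --> 0.
Proof. by under eq_fun do rewrite osnorm0; exact: cvg_cst. Qed.

Let add_cvg (x y : c0_seq) : osnorm (x n + y n) @[n --> \oo] --> 0.
Proof.
apply: (@cvg0 _ (fun n => osnorm (x n) + osnorm (y n))).
  by move=> n; rewrite osnorm_ge0 osnormD.
by rewrite -[0]addr0; apply: cvgD; exact: c0_cvg.
Qed.

Let scale_cvg (k : R[i]) (x : c0_seq) : osnorm (k *: x n) @[n --> \oo] --> 0.
Proof.
under eq_fun do rewrite osnormZ.
by rewrite -[0](mulr0 (nrm k)); apply: cvgM; [exact: cvg_cst|exact: c0_cvg].
Qed.

Let opp_cvg (x : c0_seq) : osnorm (- x n) @[n --> \oo] --> 0.
Proof. by under eq_fun do rewrite -scaleN1r; exact: scale_cvg. Qed.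

Definition c0_zero := C0Seq zero_cvg.
Definition c0_add x y := C0Seq (add_cvg x y).
Definition c0_opp x := C0Seq (opp_cvg x).
Definition c0_scale k x := C0Seq (scale_cvg k x).

Let addA : associative c0_add.
Proof. by move=> x y z; apply: c0_ext => n; exact: addrA. Qed.
Let addC : commutative c0_add.
Proof. by move=> x y; apply: c0_ext => n; exact: addrC. Qed.
Let add0 : left_id c0_zero c0_add.
Proof. by move=> x; apply: c0_ext => n; exact: add0r. Qed.
Let addN : left_inverse c0_zero c0_opp c0_add.
Proof. by move=> x; apply: c0_ext => n; exact: addNr. Qed.
HB.instance Definition _ := GRing.isZmodule.Build c0_seq addA addC add0 addN.

Let scaleA k l x : c0_scale k (c0_scale l x) = c0_scale (k * l) x.
Proof. by apply: c0_ext => n; exact: scalerA. Qed.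
Let scale1 : left_id 1 c0_scale.
Proof. by move=> x; apply: c0_ext => n; exact: scale1r. Qed.
Let scaleDr : right_distributive c0_scale +%R.
Proof. by move=> k x y; apply: c0_ext => n; exact: scalerDr. Qed.
Let scaleDl x : {morph c0_scale^~ x : k l / k + l}.
Proof. by move=> k l; apply: c0_ext => n; exact: scalerDl. Qed.
HB.instance Definition _ :=
  GRing.Zmodule_isLmodule.Build R[i] c0_seq scaleA scale1 scaleDr scaleDl.

Definition c0_sum : opStruct R := @OpStruct R c0_seq (fun k x =>
  sup (range (fun n => mxnorm (map_mx (fun y : c0_seq => y n) x)))).

Lemma c0_sum_has_sup k (x : 'M[c0_seq]_k) :
  has_sup (range (fun n => mxnorm (map_mx (fun y : c0_seq => y n) x))).
Proof.
split; first by eexists; exists 0%N.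
have bnd (y : c0_seq) : exists M : R, forall n, osnorm (y n) <= M.
  have : cvgn (fun n => osnorm (y n)) by apply/cvg_ex; exists 0; exact: c0_cvg.
  move=> /cvg_seq_bounded/bounded_fun_has_ubound[M hM].
  by exists M => n; apply: hM; exists n.
have [M hM] : exists M : 'I_k -> 'I_k -> R, forall i j n, osnorm (x i j n) <= M i j.
  have /choice[M hM] (ij : 'I_k * 'I_k) := bnd (x ij.1 ij.2).
  by exists (fun i j => M (i, j)) => i j; exact: (hM (i, j)).
exists (\sum_i \sum_j M i j) => _ [n _ <-].
apply: le_trans (mxnorm_le_sum _) _.
by do 2!(apply: ler_sum => ? _); rewrite mxE.
Qed.

End c0_sum.

(* Main.v *)
(* Let [x_j] be the images of the unit vectors in [X]. Row matrices (columns if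
   [X = C]) with entries [s_j x_j] have norm [(\sum_j s_j^2)^(1/2)] in [X], but
   any linear map [A] from [X] to [MIN(l_2)] sends them to matrices of norm at
   most [|A| max_j s_j]. So a long row with equal coefficients and norm 1 is
   small in any finite number of the coordinates [Y_i], while every fixed row is
   small in all but finitely many of them. By a gliding hump, a sum of [J]
   successive such rows has norm [sqrt J] in [X], but its image in the c_0-sum
   stays bounded in [J]. *)
From HB Require Import structures.
Require Import Defs.
From mathcomp Require Import all_boot all_order all_algebra.
From mathcomp Require Import all_classical all_reals all_analysis.
From mathcomp Require Import complex lra ring.
Set Implicit Arguments.
Unset Strict Implicit.
Unset Printing Implicit Defensive.
Import Order.TTheory GRing.Theory Num.Theory.
Import numFieldNormedType.Exports.
Local Open Scope classical_set_scope.
Local Open Scope ring_scope.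
Local Open Scope complex_scope.

(** * Frobenius bounds and triangle inequalities for matrix norms *)

Section matrix_norm_bounds.
Variable R : realType.

Lemma sum_sqr_ge0 (I : finType) (a : I -> R) : 0 <= \sum_i a i ^+ 2.
Proof. by apply: sumr_ge0 => i _; exact: sqr_ge0. Qed.

(** Lagrange's identity: twice the difference of the two sides is the double sum of the squares of
    [a i * b j - a j * b i]. *)
Lemma sum_CauchySchwarz (I : finType) (a b : I -> R) :
  (\sum_i a i * b i) ^+ 2 <= (\sum_i a i ^+ 2) * (\sum_i b i ^+ 2).
Proof.
have : 0 <= \sum_i \sum_j (a i * b j - a j * b i) ^+ 2.
  by apply: sumr_ge0 => i _; exact: sum_sqr_ge0.
have -> : \sum_i \sum_j (a i * b j - a j * b i) ^+ 2 =
    \sum_i \sum_j (a i ^+ 2 * b j ^+ 2) + \sum_i \sum_j (b i ^+ 2 * a j ^+ 2)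
    - 2 * \sum_i \sum_j ((a i * b i) * (a j * b j)).
  rewrite mulr_sumr -sumrN -!big_split; apply: eq_bigr => i _ /=.
  rewrite mulr_sumr -sumrN -!big_split; apply: eq_bigr => j _ /=; ring.
rewrite -!big_distrlr /=; nra.
Qed.

Lemma sum_mul_le_sqrt (I : finType) (a b : I -> R) :
  \sum_i a i * b i <= Num.sqrt (\sum_i a i ^+ 2) * Num.sqrt (\sum_i b i ^+ 2).
Proof.
rewrite -sqrtrM ?sum_sqr_ge0 //; apply: le_trans (ler_norm _) _.
by rewrite -sqrtr_sqr ler_wsqrtr // sum_CauchySchwarz.
Qed.

Lemma l2norm_ge0 (V : normedZmodType R[i]) k (h : 'cV[V]_k) : 0 <= l2norm h.
Proof. exact: sqrtr_ge0. Qed.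

Lemma l2norm_sqr (V : normedZmodType R[i]) k (h : 'cV[V]_k) :
  l2norm h ^+ 2 = \sum_i nrm (h i 0) ^+ 2.
Proof. by rewrite sqr_sqrtr ?sum_sqr_ge0. Qed.

Lemma l2normD (V : normedZmodType R[i]) k (g h : 'cV[V]_k) :
  l2norm (g + h) <= l2norm g + l2norm h.
Proof.
rewrite -(@ler_pXn2r _ 2) ?nnegrE ?addr_ge0 ?l2norm_ge0 // l2norm_sqr.
apply: (@le_trans _ _ (\sum_i (nrm (g i 0) + nrm (h i 0)) ^+ 2)).
  apply: ler_sum => i _; rewrite mxE ler_pXn2r ?nnegrE ?addr_ge0 ?nrm_ge0 //.
  exact: nrmD.
have := sum_mul_le_sqrt (fun i => nrm (g i 0)) (fun i => nrm (h i 0)).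
rewrite -/(l2norm g) -/(l2norm h) => gh.
under eq_bigr do rewrite sqrrD -mulr_natl.
rewrite !big_split /= -mulr_sumr -!l2norm_sqr; nra.
Qed.

(** Cauchy-Schwarz in each row. In both applications, to scalar and to operator matrices, [a i j] is
    the norm of an entry. *)
Lemma l2norm_frobenius (V W : normedZmodType R[i]) k (a : 'I_k -> 'I_k -> R)
    (g : 'cV[V]_k) (h : 'cV[W]_k) :
  (forall i, nrm (g i 0) <= \sum_j a i j * nrm (h j 0)) ->
  l2norm g <= Num.sqrt (\sum_i \sum_j a i j ^+ 2) * l2norm h.
Proof.
move=> gh; rewrite -sqrtrM; last by apply: sumr_ge0 => i _; exact: sum_sqr_ge0.
rewrite ler_wsqrtr // mulr_suml; apply: ler_sum => i _.
apply: le_trans (sum_CauchySchwarz _ _).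
by rewrite ler_pXn2r ?nnegrE ?nrm_ge0 // (le_trans (nrm_ge0 _) (gh i)).
Qed.

Lemma smxnorm_frobenius k (A : 'M[R[i]]_k) :
  smxnorm A <= Num.sqrt (\sum_i \sum_j nrm (A i j) ^+ 2).
Proof.
apply: ge_sup; first by case: (smxnorm_has_sup A).
move=> _ [v /= v1 <-].
apply: le_trans (@l2norm_frobenius _ _ _ (fun i j => nrm (A i j)) _ v _) _.
  move=> i; rewrite mxE; apply: le_trans (nrm_sum _) _.
  by apply: ler_sum => j _; rewrite nrmM.
by rewrite ler_piMr ?sqrtr_ge0.
Qed.

Lemma opmxnorm_frobenius (H : hilbertSpace R) k (a : 'M[bop H]_k) :
  opmxnorm a <= Num.sqrt (\sum_i \sum_j nrm (a i j) ^+ 2).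
Proof.
apply: ge_sup; first by case: (opmxnorm_has_sup a).
move=> _ [h /= h1 <-].
apply: le_trans (@l2norm_frobenius _ _ _ (fun i j => nrm (a i j)) _ h _) _.
  move=> i; rewrite mxE; apply: le_trans (nrm_sum _) _.
  by apply: ler_sum => j _; exact: opnormP.
by rewrite ler_piMr ?sqrtr_ge0.
Qed.

Lemma opmxnorm_ub_l2norm (H : hilbertSpace R) k (a : 'M[bop H]_k) (h : 'cV[H]_k) :
  l2norm h <= 1 -> l2norm (\col_i \sum_j a i j (h j 0)) <= opmxnorm a.
Proof. by move=> h1; apply: (sup_upper_bound (opmxnorm_has_sup a)); exists h. Qed.

Lemma opmxnorm_ge0 (H : hilbertSpace R) k (a : 'M[bop H]_k) : 0 <= opmxnorm a.
Proof.
apply: le_trans (l2norm_ge0 _) (@opmxnorm_ub_l2norm _ _ a 0 _).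
by rewrite l2norm0.
Qed.

Lemma opmxnormD (H : hilbertSpace R) k (a b : 'M[bop H]_k) :
  opmxnorm (a + b) <= opmxnorm a + opmxnorm b.
Proof.
apply: ge_sup; first by case: (opmxnorm_has_sup (a + b)).
move=> _ [h /= h1 <-].
apply: le_trans (lerD (opmxnorm_ub_l2norm a h1) (opmxnorm_ub_l2norm b h1)).
apply: le_trans (l2normD _ _); rewrite le_eqVlt; apply/orP; left; apply/eqP.
congr l2norm; apply/colP => i; rewrite !mxE -big_split; apply: eq_bigr => j _.
by rewrite mxE.
Qed.

Lemma opmxnorm_const (H : hilbertSpace R) (a : 'M[bop H]_1) : opmxnorm a = nrm (a 0 0).
Proof. by rewrite -opmxnorm1; congr opmxnorm; apply/matrixP => i j; rewrite !ord1 mxE. Qed.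

Lemma mxnorm_ge0 (E : opSpace R) k (x : 'M[E]_k) : 0 <= mxnorm x.
Proof. by have [H [j [_ _ ->]]] := opSpaceP E; exact: opmxnorm_ge0. Qed.

Lemma mxnormD (E : opSpace R) k (x y : 'M[E]_k) :
  mxnorm (x + y) <= mxnorm x + mxnorm y.
Proof.
have [H [j [_ _ jE]]] := opSpaceP E; rewrite !jE map_mxD; exact: opmxnormD.
Qed.

End matrix_norm_bounds.

(** * Matrices supported on one row or one column *)

Section hook.
Variable R : realType.

(* The first row (if [b]) or the first column of the matrix is [v 0, v 1, ...]. *)
Definition hook (V : nmodType) (b : bool) k (v : nat -> V) : 'M[V]_k :=
  \matrix_(i, j) if (if b then i else j) == 0%N :> nat
                 then v (if b then j else i) else 0.

Lemma hookD (V : nmodType) b k (u v : nat -> V) :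
  hook b k (fun j => u j + v j) = hook b k u + hook b k v.
Proof. by apply/matrixP => i j; rewrite !mxE; case: ifP; rewrite ?addr0. Qed.

Lemma map_hook (V W : nmodType) (f : V -> W) b k (v : nat -> V) : f 0 = 0 ->
  map_mx f (hook b k v) = hook b k (f \o v).
Proof. by move=> f0; apply/matrixP => i j; rewrite !mxE; case: ifP. Qed.

(** Reduces entrywise bounds on a hook to a sum over one index; [g] will be the norm or its square.
    Exchanging the two sums turns the column case into the row case. *)
Lemma sum_hook (V : nmodType) (g : V -> R) b k (v : nat -> V) : g 0 = 0 ->
  \sum_i \sum_j g (hook b k v i j) = \sum_(j < k) g (v j).
Proof.
move=> g0; transitivity (\sum_i \sum_j g (hook true k v i j)).
  by case: b => //; rewrite exchange_big; do 2!(apply: eq_bigr => ? _); rewrite !mxE.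
case: k => [|k]; first by rewrite !big_ord0.
rewrite (bigD1 0) //= [X in _ + X]big1 ?addr0 => [|i i0].
  by apply: eq_bigr => j _; rewrite mxE.
by apply: big1 => j _; rewrite mxE ifF ?g0 //; apply/negbTE.
Qed.

End hook.

(** The size [k] of a hook and the length [n] of the support of its coefficients vary independently
    below. *)
Lemma sum_ord_le (R : realType) (f : nat -> R) n k : (forall j, 0 <= f j) ->
  (forall j, (n <= j)%N -> f j = 0) -> \sum_(j < k) f j <= \sum_(j < n) f j.
Proof.
move=> f0 fn; rewrite -!(big_mkord xpredT f).
have [kn|nk] := leqP k n.
  by rewrite [leRHS](big_cat_nat (leq0n k) kn) /= lerDl sumr_ge0.
rewrite (big_cat_nat (leq0n n) (ltnW nk)) /= [X in _ + X]big_nat_cond.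
by rewrite [X in _ + X]big1 ?addr0 // => j /andP[/andP[nj _] _]; exact: fn.
Qed.

(** * The gliding hump in the c_0-sum *)

Section gliding_hump.
Variables (R : realType) (Y : nat -> opSpace R) (y : nat -> c0_seq Y) (b : bool).

Let comb m k (s : nat -> R) : 'M[Y m]_k := hook b k (fun j => (s j)%:C *: y j m).

Let combD m k s t : mxnorm (comb m k (fun j => s j + t j)) <=
  mxnorm (comb m k s) + mxnorm (comb m k t).
Proof.
rewrite /comb (_ : (fun j => (s j + t j)%:C *: y j m) =
  (fun j => (s j)%:C *: y j m + (t j)%:C *: y j m)).
  by rewrite hookD; exact: mxnormD.
by apply/funext => j; rewrite rmorphD scalerDl.
Qed.

(** Only finitely many [y j] occur, and the coordinates of each tend to 0. One [N] serves all sizes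
    [k] because the hook is bounded by the sum of the norms of its entries. *)
Let comb_tail n (s : nat -> R) (e : R) : 0 < e ->
  (forall j, (n <= j)%N -> s j = 0) ->
  exists N, forall m k, (N <= m)%N -> mxnorm (comb m k s) <= e.
Proof.
move=> e0 sn.
have : (\sum_(j < n) osnorm ((s j)%:C *: y j m)) @[m --> \oo] --> \sum_(j < n) (0 : R).
  apply: cvg_big => [|j _]; first exact: add_continuous.
  exact: (c0_cvg ((s j)%:C *: y j)).
rewrite big1 // => /cvgrPdist_le/(_ _ e0)[N _ hN]; exists N => m k Nm.
have := hN m Nm; rewrite /= sub0r normrN => /(le_trans (ler_norm _)); apply: le_trans.
apply: le_trans (mxnorm_le_sum _) _.
rewrite (sum_hook (g := @osnorm _ (Y m))) ?osnorm0 //.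
apply: (sum_ord_le (f := fun j => osnorm ((s j)%:C *: y j m))) => j.
  exact: osnorm_ge0.
by move=> /sn ->; rewrite scale0r osnorm0.
Qed.

(* Each step appends a block of [p] equal coefficients [1 / sqrt p]. A long
   block is small in the first coordinates (by [hD]) and the combination built
   so far is small in the others, so no coordinate sees two large pieces. *)
Lemma gliding_hump (M : R) (D : nat -> R) : 0 <= M ->
  (forall m k s,
    mxnorm (comb m k s) <= M * Num.sqrt (\sum_(j < k) s j ^+ 2)) ->
  (forall m k s c, (forall j, 0 <= s j <= c) -> mxnorm (comb m k s) <= D m * c) ->
  forall J (e : R), 0 < e -> exists n s,
    [/\ forall j, (n <= j)%N -> s j = 0, \sum_(j < n) s j ^+ 2 = J%:R
      & forall m k, mxnorm (comb m k s) <= M + J%:R * e].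
Proof.
move=> M0 hM hD J e e0; elim: J => [|J [n [s [sn sJ se]]]].
  exists 0%N, (fun=> 0); split => // [|m k]; first by rewrite big_ord0.
  apply: le_trans (hM _ _ _) _.
  by rewrite big1 ?sqrtr0 ?mulr0 ?mul0r ?addr0 // => j _; rewrite expr0n.
have [N hN] := comb_tail e0 sn.
(* [D'] bounds [D m] for all [m < N] at once, and [p] is such that the square root of [p.+1] exceeds
   [D' / e]; hence [D m * c <= e] for these [m]. The block length [p.+1] is never 0. *)
pose D' := \sum_(m < N) `|D m|.
have D'0 : 0 <= D' by apply: sumr_ge0.
pose p := Num.truncn ((D' / e) ^+ 2); pose c : R := (Num.sqrt p.+1%:R)^-1.
have q0 : 0 < Num.sqrt p.+1%:R :> R by rewrite sqrtr_gt0 ltr0n.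
have c0 : 0 <= c by rewrite invr_ge0 ltW.
have cc : p.+1%:R * c ^+ 2 = 1.
  by rewrite exprVn sqr_sqrtr ?ler0n // mulfV // pnatr_eq0.
have Dc m : (m < N)%N -> D m * c <= e.
  move=> mN; rewrite ler_pdivrMr // mulrC -ler_pdivrMr //.
  apply: (@le_trans _ _ (D' / e)).
    rewrite ler_pM2r ?invr_gt0 //; apply: le_trans (ler_norm _) _.
    by rewrite /D' (bigD1 (Ordinal mN)) //= lerDl sumr_ge0.
  rewrite -(ger0_norm (divr_ge0 D'0 (ltW e0))) -sqrtr_sqr ler_wsqrtr //.
  exact/ltW/truncnS_gt.
(* The block begins where the support of [s] has ended, so the sums of squares add without cross
   terms. *)
pose t j := if (n <= j < n + p.+1)%N then c else 0.
have tn j : (j < n)%N -> t j = 0 by move=> jn; rewrite /t leqNgt jn.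
have tp (i : 'I_p.+1) : t (n + i)%N = c by rewrite /t leq_addr ltn_add2l ltn_ord.
have t_large j : (n + p.+1 <= j)%N -> t j = 0.
  by move=> h; rewrite /t [(j < _)%N]ltnNge h andbF.
have t1 : \sum_(j < n + p.+1) t j ^+ 2 = 1.
  rewrite big_split_ord /= big1 ?add0r => [|i _]; last by rewrite tn ?expr0n.
  by under eq_bigr do rewrite tp; rewrite sumr_const card_ord -mulr_natl.
exists (n + p.+1)%N, (fun j => s j + t j); split.
- by move=> j h; rewrite t_large // sn ?addr0 // (leq_trans (leq_addr _ _) h).
- rewrite big_split_ord /= -[J.+1]addn1 natrD; congr (_ + _).
    by rewrite -sJ; apply: eq_bigr => i _; rewrite tn ?addr0.
  transitivity (\sum_(i < p.+1) c ^+ 2).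
    by apply: eq_bigr => i _; rewrite tp sn ?leq_addr // add0r.
  by rewrite sumr_const card_ord -[LHS]mulr_natl cc.
move=> m k; apply: le_trans (combD _ _ _ _) _.
have J1e : M + J.+1%:R * e = (M + J%:R * e) + e by rewrite -natr1 mulrDl mul1r addrA.
have [mN|Nm] := ltnP m N.
  rewrite J1e; apply: lerD; first exact: se.
  apply: le_trans (Dc _ mN); apply: hD => j.
  by rewrite /t; case: ifP => _; rewrite ?c0 ?lexx.
(* For [N <= m] the inductive bound is dropped: the old part is at most [e] and the block, of l_2
   norm 1, at most [M]. So [M] never accumulates. *)
apply: (@le_trans _ _ (e + M)).
  apply: lerD; first exact: hN.
  apply: le_trans (hM _ _ _) _; rewrite ler_piMr // -[leRHS]sqrtr1 ler_wsqrtr // -t1.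
  apply: (sum_ord_le (f := fun j => t j ^+ 2)) => j; first exact: sqr_ge0.
  by move=> h; rewrite t_large ?expr0n.
by rewrite addrC J1e lerD2r lerDl mulr_ge0 // ltW.
Qed.

End gliding_hump.

(** * Hooks over a minimal operator space *)

Section MIN_hook.
Variables (R : realType) (E : completeNormedModType R[i]).

Lemma nrm_le_osnorm_MIN (f : {scalar E}) (v : MIN E) :
  (forall w, `|f w| <= `|w|) -> nrm (f v) <= osnorm v.
Proof.
move=> f1; apply: (@le_trans _ _ (smxnorm (map_mx f (const_mx v : 'M[E]_1)))).
  pose w : 'cV[R[i]]_1 := const_mx 1.
  have w1 : l2norm w <= 1.
    by rewrite /l2norm big_ord1 mxE sqrtr_sqr (nrm_real ler01) normr1.
  apply: le_trans (sup_upper_bound (smxnorm_has_sup _) _); last by exists w.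
  apply: le_trans (nrm_le_l2norm _ 0); rewrite mxE big_ord1 !mxE mulr1 //.
by apply: (sup_upper_bound (MIN_has_sup _)); exists f.
Qed.

(* By duality, [(\sum_j |f (s_j A x_j)|^2)^(1/2)] is attained by [f \o A] on a
   combination of the [x_j] whose norm is at most [max s_j]. *)
Lemma MIN_hook_le (X : opStruct R) (x : nat -> X) (A : {linear X -> MIN E})
    (K : R) b k (s : nat -> R) (c : R) :
  (forall n (l : nat -> R[i]), osnorm (\sum_(j < n) l j *: x j) <=
    Num.sqrt (\sum_(j < n) nrm (l j) ^+ 2)) ->
  0 <= K -> (forall v, osnorm (A v) <= K * osnorm v) ->
  (forall j, 0 <= s j <= c) ->
  mxnorm (hook b k (fun j => (s j)%:C *: A (x j))) <= K * c.
Proof.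
move=> hx K0 hA sc; have c0 : 0 <= c by have /andP[/le_trans] := sc 0%N; apply.
apply: ge_sup; first by case: (MIN_has_sup (hook b k (fun j => (s j)%:C *: A (x j)))).
move=> _ [f /= f1 <-]; apply: le_trans (smxnorm_frobenius _) _.
rewrite map_hook ?linear0 // (sum_hook (g := fun z => nrm z ^+ 2)); last first.
  by rewrite nrm0 expr0n.
pose a j : R[i] := f (A (x j)).
have -> : \sum_(j < k) nrm ((f \o (fun j => (s j)%:C *: A (x j))) j) ^+ 2 =
    \sum_(j < k) (s j) ^+ 2 * nrm (a j) ^+ 2.
  apply: eq_bigr => j _ /=; have /andP[s0 _] := sc j.
  by rewrite linearZ /= nrmM nrm_real // exprMn.
set S := \sum_(j < k) _.
have S0 : 0 <= S by apply: sumr_ge0 => j _; rewrite mulr_ge0 ?sqr_ge0.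
(* The extremal combination before normalisation: [f \o A] sends it to [S], while its coefficients
   have l_2 norm at most [c] times the root of [S], as [s j ^+ 4 <= c ^+ 2 * s j ^+ 2]. This gives
   [Sle], from which the root of [S] cancels unless it is 0. *)
pose l j : R[i] := (s j ^+ 2)%:C * Num.conj (a j).
have fS : f (A (\sum_(j < k) l j *: x j)) = S%:C.
  rewrite !linear_sum rmorph_sum; apply: eq_bigr => j _.
  rewrite !linearZ /= -/(a j) /l [RHS]rmorphM -mulrA; congr (_ * _).
  by rewrite mulrC -normCK nrmE rmorphXn.
have Sle : S <= K * c * Num.sqrt S.
  rewrite -[leLHS]nrm_real // -fS; apply: le_trans (nrm_le_osnorm_MIN _ f1) _.
  apply: le_trans (hA _) _; rewrite -mulrA ler_wpM2l //.
  apply: le_trans (hx _ _) _.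
  rewrite -[c](ger0_norm c0) -sqrtr_sqr -sqrtrM ?sqr_ge0 // ler_wsqrtr //.
  rewrite /S mulr_sumr; apply: ler_sum => j _; have /andP[s0 sc'] := sc j.
  rewrite /l nrmM nrm_conj nrm_real ?sqr_ge0 // exprMn [X in X * _]expr2 -mulrA.
  by rewrite ler_wpM2r ?mulr_ge0 ?nrm_ge0 // ler_pXn2r ?nnegrE.
have := sqrtr_ge0 S; rewrite le_eqVlt => /orP[/eqP <-|q0]; first exact: mulr_ge0.
by rewrite -(ler_pM2r q0) -expr2 sqr_sqrtr.
Qed.

End MIN_hook.

(** * A criterion for non-embedding into the c_0-sum *)

Section no_embedding.
Variables (R : realType) (Y : nat -> opSpace R).

Lemma le_c0_sum_mxnorm k (x : 'M[c0_sum Y]_k) m :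
  mxnorm (map_mx (fun y : c0_seq Y => y m) x) <= mxnorm x.
Proof. by apply: (sup_upper_bound (c0_sum_has_sup x)); exists m. Qed.

Lemma c0_sum_mxnorm_ge0 k (x : 'M[c0_sum Y]_k) : 0 <= mxnorm x.
Proof. exact: le_trans (mxnorm_ge0 _) (le_c0_sum_mxnorm x 0). Qed.

(** The constant in [cb_on] may be any real; where the matrix norms of the domain are nonnegative it
    can be replaced by its absolute value. *)
Lemma cb_on_ge0 (E F : opStruct R) (A : set E) (T : E -> F) :
  (forall k (x : 'M[E]_k), (forall i j, A (x i j)) -> 0 <= mxnorm x) -> cb_on A T ->
  exists2 M : R, 0 <= M & forall k (x : 'M[E]_k), (forall i j, A (x i j)) ->
    mxnorm (map_mx T x) <= M * mxnorm x.
Proof.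
move=> E0 [M hM]; exists `|M| => // k x Ax; apply: le_trans (hM k x Ax) _.
by rewrite ler_wpM2r ?E0 // ler_norm.
Qed.

Lemma osnorm_map (E F : opStruct R) (T : E -> F) v :
  osnorm (T v) = mxnorm (map_mx T (const_mx v : 'M[E]_1)).
Proof. by congr mxnorm; apply/matrixP => i j; rewrite !mxE. Qed.

Lemma MIN_mxnorm_ge0 (E : completeNormedModType R[i]) k (x : 'M[MIN E]_k) :
  0 <= mxnorm x.
Proof.
have [[r [f f1 _]] _] := MIN_has_sup x.
apply: (@le_trans _ _ (smxnorm (map_mx f x))); last first.
  by apply: (sup_upper_bound (MIN_has_sup x)); exists f.
apply: le_trans (l2norm_ge0 _) (sup_upper_bound (smxnorm_has_sup _) _).
by exists 0; rewrite //= l2norm0.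
Qed.

(** The common core of the four cases. The two bounds on hooks make their norm in [X] exactly
    Hilbertian; the bound on scalar combinations is what [MIN_hook_le] requires. [X] is a bare
    [opStruct], so nonnegativity of its matrix norms is assumed. *)
Lemma no_embedding (X : opStruct R) (x : nat -> X) (b : bool) :
  (forall k (z : 'M[X]_k), 0 <= mxnorm z) ->
  (forall k (s : nat -> R),
    mxnorm (hook b k (fun j => (s j)%:C *: x j)) <= Num.sqrt (\sum_(j < k) s j ^+ 2)) ->
  (forall k (s : nat -> R),
    Num.sqrt (\sum_(j < k) s j ^+ 2) <= mxnorm (hook b k (fun j => (s j)%:C *: x j))) ->
  (forall n (l : nat -> R[i]), osnorm (\sum_(j < n) l j *: x j) <=
    Num.sqrt (\sum_(j < n) nrm (l j) ^+ 2)) ->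
  (forall i, completely_isomorphic (Y i) (MIN (ell2 R))) ->
  ~ completely_embeds X (c0_sum Y).
Proof.
move=> X0 hU hL hB hY [T [Tinj Tcb [S ST Scb]]].
have [M M0 hM] := cb_on_ge0 (fun k z _ => X0 k z) Tcb.
have [L L0 hL'] := cb_on_ge0 (fun k z _ => c0_sum_mxnorm_ge0 z) Scb.
pose v k (s : nat -> R) : 'M[X]_k := hook b k (fun j => (s j)%:C *: x j).
have Thook k s : map_mx T (v k s) = hook b k (fun j => (s j)%:C *: T (x j)).
  by rewrite map_hook ?linear0 //; congr hook; apply/funext => j /=; rewrite linearZ.
have coord m k s : map_mx (fun y : c0_seq Y => y m) (map_mx T (v k s)) =
    hook b k (fun j => (s j)%:C *: T (x j) m).
  by rewrite Thook map_hook.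
have hM' m k s : mxnorm (hook b k (fun j => (s j)%:C *: T (x j) m)) <=
    M * Num.sqrt (\sum_(j < k) s j ^+ 2).
  rewrite -coord; apply: le_trans (le_c0_sum_mxnorm _ _) _.
  by apply: le_trans (hM _ _ _) _ => //; rewrite ler_wpM2l ?hU.
(* Pass from [X] through the coordinate [m] to [MIN], apply [MIN_hook_le] there, and return by the
   inverse isomorphism. The isomorphism constants depend on [m], hence so does [D]. *)
have /choice[D hD] m : exists D : R, forall k s c, (forall j, 0 <= s j <= c) ->
    mxnorm (hook b k (fun j => (s j)%:C *: T (x j) m)) <= D * c.
  have [A [B [AB BA Acb Bcb]]] := hY m.
  have [K1 K10 hA] := cb_on_ge0 (fun k (z : 'M[Y m]_k) _ => mxnorm_ge0 z) Acb.
  have [K2 K20 hB'] := cb_on_ge0 (fun k (z : 'M[MIN (ell2 R)]_k) _ => MIN_mxnorm_ge0 z) Bcb.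
  have lAT : linear (fun z => A (T z m)).
    move=> k z w; rewrite linearP [(k *: T z + T w) m](_ : _ = k *: T z m + T w m) //.
    by rewrite linearP.
  pose AT : {linear X -> MIN (ell2 R)} :=
    HB.pack (fun z => A (T z m)) (GRing.isLinear.Build _ _ _ _ _ lAT).
  have ATle z : osnorm (AT z) <= K1 * M * osnorm z.
    rewrite [AT z]/= osnorm_map; apply: le_trans (hA _ _ _) _ => //.
    rewrite -mulrA ler_wpM2l //; apply: le_trans (hM _ (const_mx z : 'M[X]_1) _) => //.
    apply: le_trans (le_c0_sum_mxnorm _ m); rewrite le_eqVlt; apply/orP; left; apply/eqP.
    by congr mxnorm; apply/matrixP => i j; rewrite !mxE.
  exists (K2 * (K1 * M)) => k s c sc; rewrite -[leRHS]mulrA.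
  apply: le_trans (ler_wpM2l K20 (MIN_hook_le b k hB (mulr_ge0 K10 M0) ATle sc)).
  apply: le_trans (hB' _ _ _) => //; rewrite le_eqVlt; apply/orP; left; apply/eqP.
  congr mxnorm; rewrite map_hook ?linear0 //; congr hook.
  by apply/funext => j /=; rewrite linearZ /= AB.
(* With [J.+1] blocks and error [1 / J.+1] for each, the errors add up to 1 and the image has norm
   at most [M + 1]. The hook in [X] has norm at least the root of [J.+1], which exceeds
   [L * (M + 1)]: a contradiction with the bound [L] on the inverse. *)
pose J := Num.truncn ((L * (M + 1)) ^+ 2).
have e0 : 0 < (J.+1%:R)^-1 :> R by rewrite invr_gt0 ltr0n.
have [n [s [_ sJ hs]]] := gliding_hump M0 hM' hD J.+1 e0.
have vn : mxnorm (map_mx T (v n s)) <= M + 1.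
  apply: ge_sup; first by case: (c0_sum_has_sup (map_mx T (v n s))).
  move=> _ [m _ <-]; rewrite coord; apply: le_trans (hs m n) _.
  by rewrite mulfV ?pnatr_eq0.
have vS : v n s = map_mx S (map_mx T (v n s)).
  by apply/matrixP => i j; rewrite !mxE ST.
have LM0 : 0 <= L * (M + 1) by rewrite mulr_ge0 // addr_ge0.
have : Num.sqrt (J.+1%:R) <= L * (M + 1).
  rewrite -sJ; apply: le_trans (hL _ _) _; rewrite -/(v n s) vS.
  apply: le_trans (hL' _ _ _) _; last by rewrite ler_wpM2l.
  by move=> i j; rewrite mxE; exists (v n s i j).
apply/negP; rewrite -ltNge -[ltLHS](ger0_norm LM0) -sqrtr_sqr ltr_sqrt ?ltr0n //.
exact: truncnS_gt.
Qed.

End no_embedding.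

(** * Hooks of unit vectors and of their row and column operators *)

Section hilbertian_spaces.
Variable R : realType.
Local Notation e := (@ell2_unit R).

Lemma nrm_ell2_unit j : nrm (e j) = 1.
Proof.
have := ell2_innerE (e j); rewrite inner_unit /= eqxx nrmE -rmorphXn.
by move=> /esym/complexI/eqP; rewrite sqrp_eq1 ?nrm_ge0 // => /eqP.
Qed.

Lemma sum_ell2_unitE n (l : nat -> R[i]) m :
  (\sum_(j < n) l j *: e j : ell2 R) m = if (m < n)%N then l m else 0.
Proof.
have -> : (\sum_(j < n) l j *: e j : ell2 R) m = \sum_(j < n) l j * (m == j)%:R.
  by elim/big_rec2: _ => //= i u v _ <-; rewrite addrfctE scalrfctE.
case: ltnP => [mn|nm].
  rewrite (bigD1 (Ordinal mn)) //= eqxx mulr1 big1 ?addr0 // => i im.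
  rewrite (_ : (m == i) = false) ?mulr0 //.
  by apply/negbTE; apply: contraNneq im => mi; apply/eqP/val_inj.
by rewrite big1 // => i _; rewrite gtn_eqF ?mulr0 // (leq_trans (ltn_ord i)).
Qed.

Lemma nrm_sum_ell2_unit_le n (l : nat -> R[i]) :
  nrm (\sum_(j < n) l j *: e j) <= Num.sqrt (\sum_(j < n) nrm (l j) ^+ 2).
Proof.
rewrite nrm_ell2; apply: ell2norm_le => [|N]; first exact: sqrtr_ge0.
rewrite sqr_sqrtr ?sum_sqr_ge0 // big_mkord.
pose f m := nrm ((\sum_(j < n) l j *: e j : ell2 R) m) ^+ 2.
have fE j : f j = if (j < n)%N then nrm (l j) ^+ 2 else 0.
  by rewrite /f sum_ell2_unitE; case: ifP => // _; rewrite nrm0 expr0n.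
apply: le_trans (sum_ord_le (f := f) N (n := n) _ _) _.
- by move=> j; exact: sqr_ge0.
- by move=> j nj; rewrite fE ltnNge nj.
by apply: ler_sum => j _; rewrite fE ltn_ord.
Qed.

(** The Frobenius bound asks only for contractions, so it gives the upper estimate in all four
    spaces, including every representation entering [MAX]. *)
Lemma opmxnorm_hook_le (H : hilbertSpace R) (a : nat -> bop H) b k (s : nat -> R) :
  (forall j, nrm (a j) <= 1) ->
  opmxnorm (hook b k (fun j => (s j)%:C *: a j)) <= Num.sqrt (\sum_(j < k) s j ^+ 2).
Proof.
move=> a1; apply: le_trans (opmxnorm_frobenius _) _; rewrite ler_wsqrtr //.
rewrite (sum_hook (g := fun z : bop H => nrm z ^+ 2)) ?nrm0 ?expr0n //.
apply: ler_sum => j _; rewrite nrmZ exprMn.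
rewrite [nrm _ ^+ 2]nrm_sqr /= [0 ^+ 2]expr0n addr0 ler_piMr ?sqr_ge0 //.
by rewrite expr_le1 ?nrm_ge0.
Qed.

(** With [S] the sum of squares, test on the unit vector with entries [s j / sqrt S] times [e j]:
    each row operator carries [e j] to [e 0], so the first entry of the image is [sqrt S] times
    [e 0]. *)
Lemma opmxnorm_row_ge k (s : nat -> R) :
  Num.sqrt (\sum_(j < k) s j ^+ 2) <=
  opmxnorm (hook true k (fun j => (s j)%:C *: row_op (e j))).
Proof.
case: k => [|k]; first by rewrite big_ord0 sqrtr0 opmxnorm_ge0.
set S := \sum_(j < _) _; have := sqrtr_ge0 S.
rewrite le_eqVlt => /orP[/eqP <-|S0]; first exact: opmxnorm_ge0.
have SS : Num.sqrt S ^+ 2 = S by rewrite sqr_sqrtr ?sum_sqr_ge0.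
pose t := (Num.sqrt S)^-1.
pose h : 'cV[ell2H R]_k.+1 := \col_j ((t * s j)%:C *: e j).
have h1 : l2norm h <= 1.
  rewrite /l2norm (_ : \sum_i _ = 1) ?sqrtr1 //.
  transitivity (\sum_(j < k.+1) t ^+ 2 * s j ^+ 2).
    apply: eq_bigr => j _; rewrite mxE [nrm _]nrmZ nrm_ell2_unit mulr1.
    by rewrite nrm_sqr /= expr0n addr0 exprMn.
  by rewrite -mulr_sumr -/S /t exprVn SS mulVf // -SS expf_neq0 // gt_eqF.
apply: le_trans (opmxnorm_ub_l2norm _ h1).
apply: le_trans (nrm_le_l2norm _ 0); rewrite mxE.
have -> : \sum_j hook true k.+1 (fun j => (s j)%:C *: row_op (e j)) 0 j (h j 0) =
    (Num.sqrt S)%:C *: e 0.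
  transitivity (\sum_(j < k.+1) (t * s j ^+ 2)%:C *: e 0).
    apply: eq_bigr => j _; rewrite !mxE row_op_unit.
    change ((s j)%:C *: matrix_unit R 0 j ((t * s j)%:C *: e j) = (t * s j ^+ 2)%:C *: e 0).
    rewrite matrix_unitE [((t * s j)%:C *: e j) j](_ : _ = (t * s j)%:C * e j j) //.
    by rewrite /= eqxx mulr1 scalerA -rmorphM mulrCA -expr2.
  rewrite -scaler_suml -rmorph_sum -mulr_sumr -/S; congr (_%:C *: _).
  by rewrite -[X in _ * X]SS expr2 /t mulKf // gt_eqF.
by rewrite [nrm _]nrmZ nrm_ell2_unit mulr1 nrm_real ?sqrtr_ge0.
Qed.

(** Test on the vector with [e 0] in the first slot: its image has entries [s i] times [e i]. *)
Lemma opmxnorm_column_ge k (s : nat -> R) :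
  Num.sqrt (\sum_(j < k) s j ^+ 2) <=
  opmxnorm (hook false k (fun j => (s j)%:C *: column_op (e j))).
Proof.
case: k => [|k]; first by rewrite big_ord0 sqrtr0 opmxnorm_ge0.
pose h : 'cV[ell2H R]_k.+1 := \col_j (if j == 0 then e 0 else 0).
have h1 : l2norm h <= 1.
  rewrite /l2norm (bigD1 0) //= big1 => [|j j0].
    by rewrite addr0 mxE eqxx [nrm _]nrm_ell2_unit expr1n sqrtr1.
  by rewrite mxE (negbTE j0) nrm0 expr0n.
apply: le_trans (opmxnorm_ub_l2norm _ h1).
rewrite ler_wsqrtr //; apply: ler_sum => i _; rewrite mxE (bigD1 0) //= big1.
  rewrite addr0 !mxE eqxx /=.
  change (s i ^+ 2 <= nrm ((s i)%:C *: matrix_unit R i 0 (e 0)) ^+ 2).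
  rewrite matrix_unitE /= scale1r [nrm _]nrmZ nrm_ell2_unit mulr1.
  by rewrite nrm_sqr /= expr0n addr0.
by move=> j j0; rewrite [h j 0]mxE (negbTE j0) bop0.
Qed.

(** * Non-embedding of the four spaces *)

Variable Y : nat -> opSpace R.
Hypothesis hY : forall i, completely_isomorphic (Y i) (MIN (ell2 R)).

(** Treats R and C together, with [T] equal to [row_op] or [column_op]. The shape [b] has to match:
    a column of row operators [s j] times [row_op (e j)], or a row of the column ones, only has norm
    the maximum of the absolute values of the [s j]. *)
Lemma closed_span_no_embedding (A : set (bop (ell2H R))) (x : nat -> closed_span A)
    (T : ell2 R -> bop (ell2H R)) (b : bool) :
  linear T -> (forall v, nrm (T v) = nrm v) ->
  (forall j, closed_span_val (x j) = T (e j)) ->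
  (forall k (s : nat -> R), Num.sqrt (\sum_(j < k) s j ^+ 2) <=
    opmxnorm (hook b k (fun j => (s j)%:C *: T (e j)))) ->
  ~ completely_embeds (closed_span_os A) (c0_sum Y).
Proof.
move=> lT nT xT hT.
pose vl : {linear closed_span A -> bop (ell2H R)} := \val.
have valE k (s : nat -> R) :
    mxnorm (hook b k (fun j => (s j)%:C *: x j) : 'M[closed_span_os A]_k) =
    opmxnorm (hook b k (fun j => (s j)%:C *: T (e j))).
  apply: (congr1 (@opmxnorm R (ell2H R) k)).
  rewrite (map_hook (f := vl)) ?linear0 //; apply: (congr1 (hook b k)).
  by apply/funext => j; rewrite -xT; exact: (linearZ_LR vl).
apply: (@no_embedding R Y (closed_span_os A) x b _ _ _ _ hY).
- by move=> k z; exact: opmxnorm_ge0.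
- move=> k s; rewrite valE; apply: opmxnorm_hook_le => j.
  by rewrite nT nrm_ell2_unit.
- by move=> k s; rewrite valE.
move=> n l; apply: le_trans (nrm_sum_ell2_unit_le n l).
pose T' : {linear ell2 R -> bop (ell2H R)} :=
  HB.pack T (GRing.isLinear.Build _ _ _ _ _ lT).
have osE (z : closed_span A) : osnorm (z : closed_span_os A) = nrm (vl z).
  by rewrite [LHS]opmxnorm_const !mxE.
rewrite osE -nT -[T]/(T' : _ -> _) !linear_sum le_eqVlt; apply/orP; left; apply/eqP.
congr nrm; apply: eq_bigr => j _; rewrite !linearZ_LR; congr (_ *: _); exact: xT.
Qed.

Lemma row_space_no_embedding : ~ completely_embeds (row_space R) (c0_sum Y).
Proof.
apply: (@closed_span_no_embedding _ (fun j => row_map (e j)) (@row_op R) true) => //.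
- exact: row_op_linear.
- exact: nrm_row_op.
- exact: opmxnorm_row_ge.
Qed.

Lemma column_space_no_embedding : ~ completely_embeds (column_space R) (c0_sum Y).
Proof.
apply: (@closed_span_no_embedding _ (fun j => column_map (e j)) (@column_op R) false) => //.
- exact: column_op_linear.
- exact: nrm_column_op.
- exact: opmxnorm_column_ge.
Qed.

Let row_op_lin : {linear ell2 R -> bop (ell2H R)} :=
  HB.pack (@row_op R) (GRing.isLinear.Build _ _ _ _ _ (@row_op_linear R)).
Let column_op_lin : {linear ell2 R -> bop (ell2H R)} :=
  HB.pack (@column_op R) (GRing.isLinear.Build _ _ _ _ _ (@column_op_linear R)).

Let map_hookZ (T : {linear ell2 R -> bop (ell2H R)}) b k (s : nat -> R) :
  map_mx T (hook b k (fun j => (s j)%:C *: e j)) =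
  hook b k (fun j => (s j)%:C *: T (e j)).
Proof.
by rewrite map_hook ?linear0 //; congr hook; apply/funext => j /=; rewrite linearZ_LR.
Qed.

Lemma row_cap_column_mxnorm k (z : 'M[ell2 R]_k) :
  mxnorm (z : 'M[row_cap_column R]_k) =
  Num.max (opmxnorm (map_mx (@row_op R) z)) (opmxnorm (map_mx (@column_op R) z)).
Proof.
apply: (congr2 Num.max); apply: (congr1 (@opmxnorm R (ell2H R) k)).
  by apply/matrixP => i j; rewrite !mxE.
by apply/matrixP => i j; rewrite !mxE.
Qed.

(** Row hooks are used: the R component alone gives the lower estimate, and both components obey the
    Frobenius bound. *)
Lemma row_cap_column_no_embedding :
  ~ completely_embeds (row_cap_column R) (c0_sum Y).
Proof.
apply: (@no_embedding _ _ (row_cap_column R) e true) hY.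
- move=> k z; rewrite row_cap_column_mxnorm le_max; apply/orP; left.
  exact: opmxnorm_ge0.
- move=> k s; rewrite row_cap_column_mxnorm ge_max.
  rewrite (map_hookZ row_op_lin) (map_hookZ column_op_lin).
  apply/andP; split; apply: opmxnorm_hook_le => j.
    by rewrite [nrm _]nrm_row_op nrm_ell2_unit.
  by rewrite [nrm _]nrm_column_op nrm_ell2_unit.
- move=> k s; rewrite row_cap_column_mxnorm le_max (map_hookZ row_op_lin).
  by apply/orP; left; exact: opmxnorm_row_ge.
move=> n l; apply: le_trans (nrm_sum_ell2_unit_le n l).
rewrite /osnorm row_cap_column_mxnorm !opmxnorm_const.
by rewrite !mxE nrm_row_op nrm_column_op maxxx.
Qed.

(** [row_op] is one of the contractions in the supremum, which gives the lower estimate; the upper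
    ones hold for each contraction separately. *)
Lemma MAX_no_embedding : ~ completely_embeds (MAX (ell2 R)) (c0_sum Y).
Proof.
have row_le k (z : 'M[ell2 R]_k) :
    opmxnorm (map_mx row_op_lin z) <= mxnorm (z : 'M[MAX (ell2 R)]_k).
  apply: (sup_upper_bound (MAX_has_sup z)); exists (ell2H R), row_op_lin.
  by split => // v; rewrite !nrmE nrm_row_op.
apply: (@no_embedding _ _ (MAX (ell2 R)) e true) hY.
- by move=> k z; exact: le_trans (opmxnorm_ge0 _) (row_le _ _).
- move=> k s; apply: ge_sup; first by case: (MAX_has_sup (hook true k (fun j => (s j)%:C *: e j))).
  move=> _ [H [u [u1 ->]]].
  rewrite map_hook ?linear0 // (_ : _ \o _ = fun j => (s j)%:C *: u (e j)).
    by apply: opmxnorm_hook_le => j; rewrite -(nrm_ell2_unit j) -lecR -!nrmE.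
  by apply/funext => j /=; rewrite linearZ_LR.
- move=> k s; apply: le_trans (row_le _ _); rewrite map_hookZ.
  exact: opmxnorm_row_ge.
move=> n l; apply: le_trans (nrm_sum_ell2_unit_le n l).
apply: ge_sup; first by case: (MAX_has_sup (const_mx (\sum_(j < n) l j *: e j) : 'M[ell2 R]_1)).
move=> _ [H [u [u1 ->]]].
rewrite opmxnorm_const !mxE -lecR -!nrmE; exact: u1.
Qed.

End hilbertian_spaces.

Theorem theorem1p8 (R : realType) (Y : nat -> opSpace R)
  (hY : forall i, completely_isomorphic (Y i) (MIN (ell2 R)))
  (X : opStruct R)
  (hX : [\/ X = row_space R, X = column_space R, X = row_cap_column R
         | X = MAX (ell2 R)]) :
  ~ completely_embeds X (c0_sum Y).
Proof.
case: hX => ->.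
- exact: row_space_no_embedding.
- exact: column_space_no_embedding.
- exact: row_cap_column_no_embedding.
- exact: MAX_no_embedding.
Qed.
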